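(* Let $n\ge 2$ be an integer and for every integer $k\ge 2$ put $$\mathbf{Syt}(n,k;q) := \frac{q^{k(k-2)}(1+q^n)}{[n+1]_q}\begin{bmatrix} n+1\\ k\end{bmatrix}_q\begin{bmatrix} n-2\\ k-2\end{bmatrix}_q .$$ Then $$\sum_{k\ge 2}\mathbf{Syt}(n,k;q)=\mathbf{Cat}(n;q),$$ and, for every integer $k\ge 2$, both triples $$\bigl(\mathrm{SYT}_{\mathrm{cdes}}(n^2,k),\ \langle\partial_{2n}\rangle,\ \mathbf{Syt}(n,k;q)\bigr)\quad\text{and}\quad \bigl(\mathrm{NCM}_{\mathrm{sh}}(n,k),\ \langle \mathrm{rot}_{2n}\rangle,\ \mathbf{Syt}(n,k;q)\bigr)$$ exhibit the cyclic sieving phenomenon, where $\langle\partial_{2n}\rangle$ and $\langle\mathrm{rot}_{2n}\rangle$ are regarded as actions of the cyclic group of order $2n$.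
   Context: Cyclic sieving: let $X$ be a finite set, $C_N$ a cyclic group of order $N$ with generator $g$ acting on $X$, and $f(q)$ a polynomial with non-negative integer coefficients. The triple $(X,C_N,f(q))$ exhibits the cyclic sieving phenomenon if for all $d\in\mathbb Z$, $|\{x\in X: g^d\cdot x=x\}|=f(\xi^d)$, where $\xi$ is a primitive $N$-th complex root of unity. The order $N$ of the group is indicated by the subscript of the generator. $q$-analogs: $[m]_q=1+q+\dots+q^{m-1}$, $[m]_q!=[m]_q\cdots[1]_q$, $\begin{bmatrix} m\\ r\end{bmatrix}_q=\frac{[m]_q!}{[r]_q![m-r]_q!}$ if $m\ge r\ge 0$ and $0$ otherwise. $\mathbf{Cat}(n;q)=\frac{1}{[n+1]_q}\begin{bmatrix} 2n\\ n\end{bmatrix}_q$. $\mathrm{NCM}(n)$ is the set of non-crossing perfect matchings of the points $1,2,\dots,2n$ placed clockwise around a circle. An edge is short if it is $\{i,i+1\}$ for some $1\le i\le 2n-1$, or $\{1,2n\}$. $\mathrm{NCM}_{\mathrm{sh}}(n,k)$ is the set of matchings in $\mathrm{NCM}(n)$ with exactly $k$ short edges. $\mathrm{rot}_{2n}$ is rotation by one step, $i\mapsto i+1 \pmod{2n}$. $\mathrm{SYT}(n^2)$ is the set of standard Young tableaux with two rows of length $n$. The bijection $\mathtt{SYTtoNCM}:\mathrm{SYT}(n^2)\to\mathrm{NCM}(n)$ sends $T$ to the unique non-crossing perfect matching in which $i$ is the smaller endpoint of its edge if and only if $i$ lies in the first row of $T$. Promotion is $\partial_{2n}:=\mathtt{SYTtoNCM}^{-1}\circ\mathrm{rot}_{2n}\circ\mathtt{SYTtoNCM}$.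 The descent set $\mathrm{Des}(T)$ is the set of $j\in\{1,\dots,2n-1\}$ such that $j+1$ appears in a row below $j$. The cyclic descent set $\mathrm{cDes}(T)\subseteq\{1,\dots,2n\}$ is defined by $\mathrm{cDes}(T)\cap[1,2n-1]=\mathrm{Des}(T)$ and $2n\in\mathrm{cDes}(T)$ if and only if $1\in\mathrm{cDes}(\partial_{2n}T)$. $\mathrm{SYT}_{\mathrm{cdes}}(n^2,k)$ is the set of $T\in\mathrm{SYT}(n^2)$ with $|\mathrm{cDes}(T)|=k$. *)

(* Defs.v *)
From HB Require Import structures.
From mathcomp Require Import all_boot all_order all_algebra all_fingroup all_field.

Set Implicit Arguments.
Unset Strict Implicit.
Unset Printing Implicit Defensive.

Import GRing.Theory.
Local Open Scope ring_scope.

(* ** Cyclic sieving *)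

Definition expgz (aT : finGroupType) (g : aT) (d : int) : aT :=
  match d with
  | Posz m => (g ^+ m)%g
  | Negz m => (g ^- m.+1)%g
  end.

(* The cyclic group is <[g]>, of order N = #[g], and it acts on the subset X of
   T through [to].  [algC] contains every complex root of unity, so ranging
   over its primitive N-th roots is the same as ranging over those of C. *)
Definition cyclic_sieving (aT : finGroupType) (g : aT) (T : finType)
    (to : T -> aT -> T) (X : {set T}) (f : {poly int}) : Prop :=
  [/\ is_action <[g]> to,
      {in X & <[g]>%g, forall x a, to x a \in X},
      forall i : nat, 0 <= f`_i
    & forall (xi : algC) (d : int), #[g]%g.-primitive_root xi ->
        #|[set x in X | to x (expgz g d) == x]|%:R
          = (map_poly intr f).[xi ^ d] ].

(* The class of i in Z/NZ acts as the i-th iterate of s.  This is an action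
   exactly when s has order dividing N, a fact which [cyclic_sieving] asserts.
   As always with 'Z_N, it is meant for N > 1; the generator is then Zp1. *)
Definition iter_action (N : nat) (T : Type) (s : T -> T) (x : T) (i : 'Z_N) : T :=
  iter i s x.

(* ** q-analogs, in the field of rational functions in q *)

Definition qnat (m : nat) : {poly int} := \sum_(i < m) 'X^i.

Definition qfact (m : nat) : {poly int} := \prod_(1 <= i < m.+1) qnat i.

Definition qbinom (m r : nat) : {fraction {poly int}} :=
  if (r <= m)%N then tofrac (qfact m) / (tofrac (qfact r) * tofrac (qfact (m - r))) else 0.

Definition qCat (n : nat) : {fraction {poly int}} :=
  (tofrac (qnat n.+1))^-1 * qbinom (2 * n) n.

(* The natural-number subtractions are exact for n, k >= 2. *)
Definition qSyt (n k : nat) : {fraction {poly int}} :=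
  tofrac ('X^(k * (k - 2)) * (1 + 'X^n)) / tofrac (qnat n.+1)
    * qbinom n.+1 k * qbinom (n - 2) (k - 2).

(* ** Non-crossing perfect matchings

   The points 1, ..., 2n are represented by 0, ..., 2n - 1, and a matching by
   its set of edges. *)

Definition perfect_matching (m : nat) (M : {set {set 'I_m}}) : bool :=
  partition M [set: 'I_m] && [forall e in M, #|e| == 2%N].

Definition crossing (m : nat) (M : {set {set 'I_m}}) : bool :=
  [exists a : 'I_m, exists b : 'I_m, exists c : 'I_m, exists d : 'I_m,
    [&& a < b, b < c, c < d, [set a; c] \in M & [set b; d] \in M]%N].

Definition NCM (n : nat) : {set {set {set 'I_(2 * n)}}} :=
  [set M | perfect_matching M && ~~ crossing M].

(* [ordS] is the cyclic successor i |-> i + 1 mod m. *)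
Definition short_edge (m : nat) (e : {set 'I_m}) : bool :=
  [exists i : 'I_m, e == [set i; ordS i]].

Definition NCMsh (n k : nat) : {set {set {set 'I_(2 * n)}}} :=
  [set M in NCM n | #|[set e in M | short_edge e]| == k].

Definition rot_matching (m : nat) (M : {set {set 'I_m}}) : {set {set 'I_m}} :=
  [set [set ordS i | i in e] | e : {set 'I_m} in M].

(* ** Standard Young tableaux with two rows of length n

   T (r, c) is the entry in row r and column c, row 0 being the top one; the
   entries 1, ..., 2n are represented by 0, ..., 2n - 1. *)

Definition is_SYT (n : nat) (T : {ffun 'I_2 * 'I_n -> 'I_(2 * n)}) : bool :=
  [&& injectiveb T,
      [forall r : 'I_2, forall c : 'I_n, forall c' : 'I_n,
         (c < c')%N ==> (T (r, c) < T (r, c'))%N]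
    & [forall c : 'I_n, forall r : 'I_2, forall r' : 'I_2,
         (r < r')%N ==> (T (r, c) < T (r', c))%N] ].

Definition SYT (n : nat) : finType :=
  {T : {ffun 'I_2 * 'I_n -> 'I_(2 * n)} | is_SYT T}.

Definition in_first_row (n : nat) (T : SYT n) (i : 'I_(2 * n)) : bool :=
  [exists c : 'I_n, val T (ord0, c) == i].

Definition smaller_endpoint (m : nat) (M : {set {set 'I_m}}) (i : 'I_m) : bool :=
  [exists j : 'I_m, (i < j)%N && ([set i; j] \in M)].

(* Exactly one matching satisfies the condition, and each matching of NCM n
   arises from exactly one tableau, so that the default values set0 here and T
   in [promotion] are never used. *)
Definition SYTtoNCM (n : nat) (T : SYT n) : {set {set 'I_(2 * n)}} :=
  odflt set0
    [pick M in NCM n | [forall i, smaller_endpoint M i == in_first_row T i]].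

Definition promotion (n : nat) (T : SYT n) : SYT n :=
  odflt T [pick T' : SYT n | SYTtoNCM T' == rot_matching (SYTtoNCM T)].

Definition Des (n : nat) (T : SYT n) : {set 'I_(2 * n)} :=
  [set j : 'I_(2 * n) |
    [exists p : 'I_2 * 'I_n, exists p' : 'I_2 * 'I_n,
      [&& val T p == j, val T p' == j.+1 :> nat & (p.1 < p'.1)%N]]].

(* The last ordinal stands for 2n and the ordinal 0 for 1; as 1 <= 2n - 1,
   membership of 1 in cDes is membership in Des. *)
Definition cDes (n : nat) (T : SYT n) : {set 'I_(2 * n)} :=
  Des T :|: [set j : 'I_(2 * n) | (j.+1 == 2 * n)%N
    && [exists i in Des (promotion T), i == 0 :> nat]].

Definition SYTcdes (n k : nat) : {set SYT n} :=
  [set T | #|cDes T| == k].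

(* Main.v *)
Require Import Defs.
From HB Require Import structures.
From mathcomp Require Import all_boot all_order all_algebra all_fingroup all_field.
From mathcomp Require Import ring zify.

(** Everything is counted on matchings. The bijection SYTtoNCM turns promotion
    into rotation by definition, and it turns cyclic descents into short edges:
    a point that opens its edge and is followed by a point that closes one must
    be matched with it, so that j is a descent exactly when {j, j+1} is an edge
    ([mem_Des]), and the rotation built into the definition of cDes settles the
    edge {2n, 1} in the same way ([mem_cDes]). Hence the two triples sieve
    together, and it remains to treat the polynomials and the rotation.

    The polynomials. Since 1 + q^n = [n+1] - q[n-1], the quotient Syt(n,k;q)
    equals q^(k(k-2)) times
      binom(n+1,k) binom(n-2,k-2) - q binom(n,k) binom(n-1,k-2)
    with Gaussian binomials, which is the polynomial [syt]. The sum over k is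
    an instance of the q-Vandermonde identity ([sum_qSyt]).

    The trivial rotation and non-negativity. Listing which points open an edge
    identifies matchings with Dyck words. The short edges are the peaks of the
    word, plus one if the first and the last point are matched, that is, if the
    word is prime. The Dyck words with k peaks, weighted by a major index, add up
    to a difference of the kind produced by the reflection principle,
      q^(k^2) (binom(n,k)^2 - binom(n+1,k) binom(n-1,k)).
    Correcting for prime words, which are Dyck words of length 2n-2 between two
    extra letters, gives q^n Syt(n,k;q) as a sum of powers of q over the
    matchings with k short edges ([dyck_sum]). So the coefficients are
    non-negative, and q = 1 counts the matchings.

    Non-trivial rotations. A power g^d has the same fixed points as the rotation
    by p = gcd(d,2n), of order r = 2n/p > 1. In a matching fixed by it, an edge
    that is not a diameter spans fewer than p steps in one of the two directions,
    since otherwise it would meet its own image. Call the end from which this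
    short arc runs clockwise an opening point; both ends of a diameter count as
    such. Recording the opening points gives a p-periodic circular word, from
    which the matching can be recovered by first returns
    ([opens_inj]). Conversely, a word occurs if and only if one period is
    balanced, or has one surplus opening letter and r = 2 ([realize_word]): the
    cycle lemma reduces this to Dyck words. Short edges become circular peaks,
    r for each peak of a period. Circular words with A opening and B closing
    letters and s peaks number
      C(A,s) C(B-1,s-1) + C(A-1,s-1) C(B,s)
    ([card_circ_peaks]), and the q-Lucas theorem evaluates Syt(n,k;q) at a root
    of unity of order r to exactly these numbers. *)

Set Implicit Arguments.
Unset Strict Implicit.
Unset Printing Implicit Defensive.

Import GRing.Theory.
Local Open Scope ring_scope.

(** * Gaussian binomials *)

Definition qint (R : comNzRingType) (q : R) (m : nat) : R := \sum_(i < m) q ^+ i.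

(** The Gaussian binomial, by the q-Pascal rule: in this form it exists in every
    commutative ring, in particular at a root of unity. *)
Fixpoint gauss (R : comNzRingType) (q : R) (n k : nat) : R :=
  match n, k with
  | _, 0 => 1
  | 0, _.+1 => 0
  | n'.+1, k'.+1 => gauss q n' k' + q ^+ k * gauss q n' k
  end.

Section QInt.
Variables (R : comNzRingType) (q : R).
Local Notation "[[ m ]]" := (qint q m) (at level 0, format "[[ m ]]").
Local Notation g := (gauss q).

Lemma qint0 : [[0]] = 0. Proof. by rewrite /qint big_ord0. Qed.
Lemma qint1 : [[1]] = 1. Proof. by rewrite /qint big_ord1. Qed.
Lemma qintSr m : [[m.+1]] = [[m]] + q ^+ m.
Proof. by rewrite /qint big_ord_recr. Qed.
Lemma qintD a b : [[a + b]] = [[a]] + q ^+ a * [[b]].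
Proof.
rewrite /qint big_split_ord /= mulr_sumr; congr (_ + _).
by apply: eq_bigr => i _; rewrite exprD.
Qed.
Lemma qintS m : [[m.+1]] = 1 + q * [[m]].
Proof. by rewrite -add1n qintD qint1 expr1. Qed.
Lemma qint_geom m : q ^+ m = 1 + (q - 1) * [[m]].
Proof. by rewrite /qint -subrX1 addrC subrK. Qed.

Lemma gauss0 n : g n 0 = 1. Proof. by case: n. Qed.
Lemma gaussS n k : g n.+1 k.+1 = g n k + q ^+ k.+1 * g n k.+1.
Proof. by []. Qed.
Lemma gauss_small n k : (n < k)%N -> g n k = 0.
Proof.
elim: n k => [|n IH] [|k] //= lt_nk.
by rewrite !IH ?mulr0 ?addr0 // ltnW.
Qed.
Lemma gaussnn n : g n n = 1.
Proof. by elim: n => //= n ->; rewrite gauss_small ?mulr0 ?addr0. Qed.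
Lemma gaussn1 n : g n 1 = [[n]].
Proof. by elim: n => [|n IH]; rewrite ?qint0 //= gauss0 IH expr1 qintS. Qed.

Lemma gaussS_right n k : g n.+1 k.+1 = g n k.+1 + q ^+ (n - k) * g n k.
Proof.
elim: n k => [|n IH] k.
  by case: k => [|k] /=; rewrite ?mulr0 ?mulr1 ?expr0 ?addr0 ?add0r.
rewrite gaussS; case: k => [|k].
  by rewrite !gauss0 !gaussn1 expr1 subn0 mulr1 -qintS qintSr.
rewrite subSS {1}(IH k) {1}(IH k.+1) (gaussS n k.+1) (gaussS n k).
have [lekn|ltnk] := leqP k.+1 n; last first.
  have [-> ->] : g n k.+1 = 0 /\ g n k.+2 = 0 by split; apply: gauss_small; lia.
  ring.
have -> : q ^+ (n - k) = q * q ^+ (n - k.+1).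
  by rewrite -exprS; congr (_ ^+ _); lia.
rewrite !(exprS _ k.+1); ring.
Qed.

Lemma gauss_absorb n k : [[k.+1]] * g n.+1 k.+1 = [[n.+1]] * g n k.
Proof.
elim: n k => [|n IH] k.
  by case: k => [|k] /=; rewrite ?mulr0 ?addr0 ?mulr0 // !qint1.
rewrite gaussS mulrDr mulrCA IH; case: k => [|k].
  by rewrite !gauss0 qint1 expr1 (qintS n.+1); ring.
rewrite (qintS k.+1) mulrDl -mulrA IH (gaussS n k) (qintS n.+1) !exprS; ring.
Qed.

Lemma gauss_absorb_right a b :
  [[b.+1]] * g (a + b).+1 a = [[(a + b).+1]] * g (a + b) a.
Proof.
case: a => [|a]; first by rewrite !gauss0 add0n.
have pascal := gaussS_right (a.+1 + b) a; have absorb := gauss_absorb (a.+1 + b) a.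
have e : (a.+1 + b - a = b.+1)%N by lia.
have E : [[(a.+1 + b).+1]] = [[b.+1]] + q ^+ b.+1 * [[a.+1]].
  by rewrite -qintD; congr qint; lia.
rewrite e in pascal; apply: (addIr (q ^+ b.+1 * [[a.+1]] * g (a.+1 + b).+1 a.+1)).
rewrite -mulrDl -E -[in RHS]mulrA absorb [in LHS]pascal; ring.
Qed.

Lemma gauss_sym n k : (k <= n)%N -> g n (n - k) = g n k.
Proof.
elim: n k => [|n IH] [|k] // lekn; first by rewrite subn0 gaussnn gauss0.
rewrite subSS; have [->|nekn] := eqVneq k n; first by rewrite subnn gaussnn gauss0.
have -> : (n - k = (n - k.+1).+1)%N by lia.
rewrite gaussS_right IH; last by lia.
have -> : (n - (n - k.+1) = k.+1)%N by lia.
have -> : ((n - k.+1).+1 = n - k)%N by lia.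
by rewrite IH.
Qed.

End QInt.

Lemma qint_morph (R S : comNzRingType) (f : {rmorphism R -> S}) q m :
  f (qint q m) = qint (f q) m.
Proof. by rewrite /qint rmorph_sum; apply: eq_bigr => i _; rewrite rmorphXn. Qed.

Lemma gauss_morph (R S : comNzRingType) (f : {rmorphism R -> S}) q n k :
  f (gauss q n k) = gauss (f q) n k.
Proof.
elim: n k => [|n IH] [|k] /=; rewrite ?rmorph1 ?rmorph0 //.
by rewrite rmorphD rmorphM rmorphXn !IH.
Qed.

(** Induction on l with [gaussS_right]; the two terms of that rule split the sum
    at l.+1 into the sums for K.+1 and for K. Truncated differences are harmless,
    because the Gaussian binomials vanish wherever a truncation occurs. *)
Lemma qVandermonde (R : comNzRingType) (q : R) l m K :
  gauss q (l + m) K =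
    \sum_(j < K.+1) q ^+ (j * (m + j - K)) * gauss q l j * gauss q m (K - j).
Proof.
elim: l K => [|l IH] K.
  rewrite big_ord_recl /= big1 ?addr0 => [|j _]; last by rewrite mulr0 mul0r.
  by rewrite mul0n mul1r subn0 mul1r.
case: K => [|K]; first by rewrite big_ord1 !gauss0 !mulr1.
rewrite addSn gaussS_right !{}IH [RHS]big_ord_recl [in LHS]big_ord_recl -addrA.
congr (_ + _); first by rewrite /= !gauss0.
rewrite mulr_sumr -big_split; apply: eq_bigr => j _.
rewrite !lift0 subSS gaussS_right mulrDr mulrDl; congr (_ + _).
have [ltlj|lejl] := ltnP l j; first by rewrite !(gauss_small _ ltlj) !(mulr0, mul0r).
have [ltmK|leKm] := ltnP m (K - j).
  by rewrite !(gauss_small _ ltmK) !(mulr0, mul0r).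
rewrite !mulrA -!exprD; congr (_ ^+ _ * _ * _); have := ltn_ord j; nia.
Qed.
Arguments gauss : simpl never.

(** * The polynomials Syt(n,k;q) *)

(** Syt(n,k;q) without division; [qSytE] shows that it is the same. *)
Definition syt (R : comNzRingType) (q : R) (n k : nat) : R :=
  q ^+ (k * (k - 2)) *
  (gauss q n.+1 k * gauss q (n - 2) (k - 2)
   - q * gauss q n k * gauss q (n - 1) (k - 2)).

(** The q-ballot number: by reflection, the difference between all words with a
    closing and b opening letters and k peaks and those that violate the ballot
    condition. It is antisymmetric under (a, b) -> (b-1, a+1), hence vanishes on
    b = a+1, which is the boundary condition of the ballot recursion. *)
Definition ballot_gauss (R : comNzRingType) (q : R) (a b k : nat) : R :=
  q ^+ (k * k) * (gauss q a k * gauss q b k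
    - if b is b'.+1 then gauss q a.+1 k * gauss q b' k else 0).

Lemma syt_morph (R S : comNzRingType) (f : {rmorphism R -> S}) q n k :
  f (syt q n k) = syt (f q) n k.
Proof. by rewrite /syt !(rmorphM, rmorphB, rmorphXn, gauss_morph). Qed.

Lemma ballot_gauss_morph (R S : comNzRingType) (f : {rmorphism R -> S}) q a b k :
  f (ballot_gauss q a b k) = ballot_gauss (f q) a b k.
Proof.
rewrite /ballot_gauss; case: b => [|b];
  by rewrite !(rmorphM, rmorphB, rmorphXn, gauss_morph, rmorph0).
Qed.

Lemma syt_small (R : comNzRingType) (q : R) n k :
  (2 <= n)%N -> (n < k)%N -> syt q n k = 0.
Proof.
move=> le2n ltnk; rewrite /syt (gauss_small _ ltnk) mulr0 mul0r subr0.
by rewrite (gauss_small q (_ : n - 2 < k - 2)%N) ?mulr0 //; lia.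
Qed.

(** As [n+1] - (1 + q^n) = q[n-1], this amounts to
    [n-1] binom(n-2,k-2) binom(n+1,k) = [n+1] binom(n,k) binom(n-1,k-2), and both
    sides are [n+1-k] binom(n+1,k) binom(n-1,k-2). *)
Lemma qint_syt (R : comNzRingType) (q : R) n k : (2 <= n)%N -> (2 <= k)%N ->
  qint q n.+1 * syt q n k =
  q ^+ (k * (k - 2)) * (1 + q ^+ n) * gauss q n.+1 k * gauss q (n - 2) (k - 2).
Proof.
move=> le2n le2k; have [lekn|ltnk] := leqP k n; last first.
  rewrite syt_small // (gauss_small q (_ : n - 2 < k - 2)%N) ?mulr0 //; lia.
case: k le2k lekn => [|[|j]] // _.
case: n {le2n} => [|[|n]] // lejn; rewrite /syt !subSS !subn0.
have [a ->] : exists a, n = (j + a)%N by exists (n - j)%N; lia.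
have E1 := gauss_absorb_right q j.+2 a; have E2 := gauss_absorb_right q j a.
rewrite !addSn in E1.
have -> : qint q (j + a).+3 = 1 + q * qint q (j + a).+1 + q ^+ (j + a).+2.
  by rewrite qintSr qintS.
move: E1 E2; rewrite [qint q (_.+3)]qintSr [qint q (_.+2)]qintS.
set x := gauss q _.+3 _; set b := gauss q _.+2 _.
set c := gauss q _.+1 _; set y := gauss q (j + a) _.
set u := qint q _.+1; set v := qint q _.+1; set w := q ^+ _.+2 => E1 E2.
transitivity (q ^+ (j.+2 * j) * ((1 + q * v + w) * x * y
   - q * c * ((1 + q * v + w) * b))); first by ring.
rewrite -E1 [X in _ - X](_ : _ = q * x * (u * c)); last by ring.
rewrite E2; ring.
Qed.

(** In a field where no [m] with m > 0 vanishes, all the Gaussian binomials involved are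
    rational multiples of binom(n-2,k-2) with denominators [k], [k-1] and
    [n-k+1], which are non-zero for 2 <= k <= n; the rest is a rational identity. *)
Lemma syt_ballot_field (F : fieldType) (q : F) n k : (2 <= k <= n)%N ->
  q != 0 -> (forall m, qint q m.+1 != 0) ->
  q ^+ n * syt q n k = ballot_gauss q n n k
    - q ^+ k * ballot_gauss q n.-1 n.-1 k
    + q ^+ k.-1 * ballot_gauss q n.-1 n.-1 k.-1.
Proof.
case: k => [|[|j]] // /andP[_].
case: n => [|[|n]] // lejn q0 qn0; rewrite /syt /ballot_gauss !subSS !subn0.
have [a ->] : exists a, n = (a + j)%N by exists (n - j)%N; lia.
have B1 := gauss_absorb q; have B2 := gauss_absorb_right q.
rewrite [_.+2.-1]/=.
move EB: (gauss q (a + j) j) => B.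
have qa : forall m, q ^+ m = 1 + (q - 1) * qint q m by exact: qint_geom.
have E1 : gauss q (a + j).+1 j.+1 = qint q (a + j).+1 / qint q j.+1 * B.
  apply: (mulfI (qn0 j)); rewrite B1 EB; field; by rewrite qn0.
have E2 : gauss q (a + j).+2 j.+2
    = qint q (a + j).+2 * qint q (a + j).+1 / (qint q j.+1 * qint q j.+2) * B.
  apply: (mulfI (qn0 j.+1)); rewrite B1 E1; field; by rewrite !qn0.
have sw b i :
    qint q b.+1 * gauss q (b + i).+1 i = qint q (b + i).+1 * gauss q (b + i) i.
  by rewrite addnC B2.
have E3 : gauss q (a + j).+1 j = qint q (a + j).+1 / qint q a.+1 * B.
  apply: (mulfI (qn0 a)); rewrite sw EB; field; by rewrite qn0.
have E4 : gauss q (a + j).+2 j.+1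
    = qint q (a + j).+2 * qint q (a + j).+1 / (qint q j.+1 * qint q a.+1) * B.
  apply: (mulfI (qn0 j)); rewrite B1 E3; field; by rewrite !qn0.
have E5 : gauss q (a + j).+3 j.+2
    = qint q (a + j).+3 * qint q (a + j).+2 * qint q (a + j).+1
      / (qint q j.+2 * qint q j.+1 * qint q a.+1) * B.
  apply: (mulfI (qn0 j.+1)); rewrite B1 E4; field; by rewrite !qn0.
have E6 : gauss q (a + j) j.+1 = qint q a / qint q j.+1 * B.
  apply: (mulfI (qn0 j)); case: a EB lejn {E1 E2 E3 E4 E5} => [|b] EB lejn.
    by rewrite add0n gauss_small // qint0; ring.
  by rewrite -EB addSn B1 -sw; field; rewrite qn0.
have E7 : gauss q (a + j).+1 j.+2
    = qint q (a + j).+1 * qint q a / (qint q j.+1 * qint q j.+2) * B.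
  apply: (mulfI (qn0 j.+1)); rewrite B1 E6; field; by rewrite !qn0.
(* Here q [a-1] is written [a] - 1, which keeps the formula true for a = 0. *)
have E8 : gauss q (a + j) j.+2
    = qint q a * (qint q a - 1) / (q * qint q j.+1 * qint q j.+2) * B.
  case: a EB lejn {E1 E2 E3 E4 E5 E7} E6 => [|b] EB lejn E6.
    by rewrite add0n gauss_small // qint0; ring.
  apply: (mulfI (qn0 j.+1)); rewrite addSn B1 (qintS q b).
  case: b EB E6 {lejn} => [|c] EB E6.
    by rewrite add0n gauss_small // qint0; ring.
  rewrite addSn -addnS -sw addnS -!addSn E6 !qintS.
  by field; rewrite -!qintS !qn0 q0.
rewrite -[j.+2.-1]/(j.+1) E1 E2 E3 E4 E5 E6 E7 E8.
have -> : (j.+2 * j.+2 = j.+2 * j + j.+2 + j.+2)%N by lia.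
have -> : (j.+1 * j.+1 = j.+2 * j + 1)%N by lia.
rewrite !exprD expr1 !qa.
move: (qn0 j) (qn0 j.+1) (qn0 a); rewrite !qintS qintD qa.
by move=> n1 n2 n3; field; rewrite n1 n2 n3 q0.
Qed.

Lemma qnat_neq0 m : qnat m.+1 != 0.
Proof.
apply/eqP => /(congr1 (fun p => p.[0])).
by rewrite -[qnat _]/(qint 'X m.+1) qintS !hornerE.
Qed.

Lemma tofrac_inj (R : idomainType) : injective (@tofrac R).
Proof. by move=> x y /eqP; rewrite tofrac_eq => /eqP. Qed.

Lemma qfact_gauss a b : qfact (a + b) = gauss 'X (a + b) a * (qfact a * qfact b).
Proof.
have qfactS m : qfact m.+1 = qfact m * qnat m.+1.
  by rewrite /qfact big_nat_recr.
have qfact0 : qfact 0 = 1 by rewrite /qfact big_geq.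
elim: a => [|a IH]; first by rewrite gauss0 qfact0 !mul1r.
rewrite addSn !qfactS IH.
transitivity (qint 'X (a + b).+1 * gauss 'X (a + b) a * (qfact a * qfact b)).
  by rewrite /qint -/(qnat _); ring.
by rewrite -gauss_absorb /qint -/(qnat _); ring.
Qed.

Lemma qbinomE n k : qbinom n k = tofrac (gauss 'X n k).
Proof.
rewrite /qbinom; case: leqP => [lekn|ltnk]; last by rewrite gauss_small ?rmorph0.
have nz m : tofrac (qfact m) != 0.
  rewrite tofrac_eq0 /qfact big_add1 /= big_mkord.
  by apply/prodf_neq0 => i _; apply: qnat_neq0.
apply: (canLR (mulfK _)); first by rewrite mulf_neq0.
by rewrite -!rmorphM -{1}(subnKC lekn) qfact_gauss subnKC.
Qed.

(** The bookkeeping of short edges: k peaks, minus the prime words with k peaks,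
    plus the prime words with k-1 peaks. Removing the outer letters of a prime
    word leaves an arbitrary Dyck word with as many peaks, and shifts the index
    of each peak by one. *)
Lemma syt_ballot (R : comNzRingType) (q : R) n k : (2 <= n)%N -> (2 <= k)%N ->
  q ^+ n * syt q n k = ballot_gauss q n n k
    - q ^+ k * ballot_gauss q n.-1 n.-1 k
    + q ^+ k.-1 * ballot_gauss q n.-1 n.-1 k.-1.
Proof.
move=> le2n le2k; have [lekn|ltnk] := leqP k n; last first.
  have E0 m j : (m < j)%N -> ballot_gauss q m m j = 0.
    move=> ltmj; rewrite /ballot_gauss gauss_small // mul0r sub0r.
    case: m ltmj => [|m] ltmj; first by rewrite oppr0 mulr0.
    by rewrite (gauss_small q (_ : m < j)%N) ?mulr0 ?oppr0 ?mulr0 //; lia.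
  by rewrite syt_small // !E0 ?mulr0 ?subr0 ?addr0 //; lia.
(* It suffices to treat the indeterminate, where division is possible. *)
pose ev : {rmorphism {poly int} -> R} :=
  (horner_eval q \o map_poly intr)%FUN.
have evX : ev 'X = q by rewrite /= map_polyX /horner_eval hornerX.
rewrite -evX -!ballot_gauss_morph -syt_morph -!rmorphXn -!rmorphM -rmorphB -rmorphD.
congr (ev _); apply: tofrac_inj.
rewrite rmorphD rmorphB (rmorphM _ 'X^n) (rmorphM _ 'X^k) (rmorphM _ 'X^(k.-1)).
rewrite !rmorphXn !ballot_gauss_morph syt_morph.
apply: syt_ballot_field; rewrite ?le2k //.
  by rewrite tofrac_eq0 polyX_eq0.
by move=> m; rewrite -qint_morph tofrac_eq0 (qnat_neq0 m).
Qed.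

Lemma qSytE n k : (2 <= n)%N -> (2 <= k)%N -> qSyt n k = tofrac (syt 'X n k).
Proof.
move=> le2n le2k; rewrite /qSyt !qbinomE.
have nz : tofrac (qnat n.+1) != 0 by rewrite tofrac_eq0 qnat_neq0.
rewrite [_ / _ * _]mulrAC [_ / _ * _]mulrAC -!rmorphM; apply: (canLR (mulfK nz)).
by rewrite -rmorphM [syt _ _ _ * _]mulrC qint_syt.
Qed.

(** After multiplication by [n+1], the terms are those of the q-Vandermonde
    expansion of binom(2n-1, n), split as (n+1) + (n-2); and
    binom(2n, n) = (1 + q^n) binom(2n-1, n). *)
Lemma sum_qSyt n K : (2 <= n)%N -> (n < K)%N ->
  \sum_(2 <= k < K) qSyt n k = qCat n.
Proof.
move=> le2n ltnK.
have nz : tofrac (qnat n.+1) != 0 by rewrite tofrac_eq0 qnat_neq0.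
have qn0 : tofrac (qnat n) != 0 by rewrite tofrac_eq0 -(prednK (ltnW le2n)) qnat_neq0.
apply: (mulfI nz); rewrite /qCat (mulVKf nz) qbinomE mulr_sumr.
have -> : gauss 'X (2 * n) n = (1 + 'X^n) * gauss 'X (n.+1 + (n - 2)) n :> {poly int}.
  apply: (mulfI (qnat_neq0 n.-1)); rewrite (prednK (ltnW le2n)).
  have := gauss_absorb_right ('X : {poly int}) n n.-1.
  have -> : (n + n.-1).+1 = (2 * n)%N by lia.
  have -> : (n.+1 + (n - 2) = n + n.-1)%N by lia.
  rewrite (prednK (ltnW le2n)) => ->.
  by rewrite mulrA mul2n -addnn qintD mulrDr mulr1 [in X in _ = X * _]mulrC.
rewrite qVandermonde mulr_sumr [RHS]rmorph_sum.
rewrite [RHS](big_ord_widen K (fun j : nat => tofrac ((1 + 'X^n)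
  * ('X^(j * (n - 2 + j - n)) * gauss 'X n.+1 j * gauss 'X (n - 2) (n - j))))) //.
rewrite [RHS]big_mkcond -[RHS](big_mkord xpredT (fun j : nat => if (j < n.+1)%N then
  tofrac ((1 + 'X^n) * ('X^(j * (n - 2 + j - n)) * gauss 'X n.+1 j
    * gauss 'X (n - 2) (n - j))) else 0)).
rewrite [RHS](big_cat_nat (n := 2)) //=; last by lia.
rewrite [X in _ = X + _]big_nat_cond [X in _ = X + _]big1 ?add0r; last first.
  move=> j /andP[/andP[_ ltj2] _].
  rewrite (gauss_small _ (_ : n - 2 < _)%N); last by lia.
  by rewrite !mulr0 rmorph0 if_same.
rewrite big_nat_cond [RHS]big_nat_cond; apply: eq_bigr => j /andP[/andP[le2j _] _].
rewrite qSytE // -rmorphM; case: ltnP => [lejn|ltnj]; last first.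
  by rewrite syt_small ?mulr0 ?rmorph0.
rewrite -[qnat _]/(qint 'X n.+1) (qint_syt _ le2n le2j); congr tofrac.
have -> : (n - 2 + j - n = j - 2)%N by lia.
have -> : gauss ('X : {poly int}) (n - 2) (n - j) = gauss 'X (n - 2) (j - 2).
  by rewrite -gauss_sym; [congr gauss; lia | lia].
by rewrite !mulrA; congr (_ * _ * _); rewrite mulrC.
Qed.

(** * Values at roots of unity *)

Section RootOfUnity.
Variables (F : fieldType) (r : nat) (w : F).
Hypotheses (r_gt1 : (1 < r)%N) (w_prim : r.-primitive_root w).

Lemma qint_root_eq0 m : (qint w m == 0) = (r %| m)%N.
Proof.
have w1 : w - 1 != 0.
  by rewrite subr_eq0 -[w]expr1 -(prim_order_dvd w_prim) dvdn1; lia.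
rewrite (prim_order_dvd w_prim) -[RHS]subr_eq0 subrX1 mulf_eq0 (negPf w1) /=.
by rewrite /qint.
Qed.

Lemma gauss_root_order j : (0 < j < r)%N -> gauss w r j = 0.
Proof.
case: j => // j /= ltjr; have nz : qint w j.+1 != 0.
  by rewrite qint_root_eq0 gtnNdvd.
apply: (mulfI nz); rewrite -(prednK (ltnW r_gt1)) gauss_absorb.
rewrite (prednK (ltnW r_gt1)) mulr0.
by have /eqP -> : qint w r == 0; rewrite ?qint_root_eq0 ?mul0r.
Qed.

(** The q-Lucas theorem: both sides satisfy the q-Pascal rule. At the step from
    a = r-1 to the next multiple of r, this uses that binom(r,j) vanishes at w for
    0 < j < r. *)
Lemma gauss_lucas m s a b : (a < r)%N -> (b < r)%N ->
  gauss w (m * r + a) (s * r + b) = 'C(m, s)%:R * gauss w a b.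
Proof.
have wr j : w ^+ (j * r) = 1 by rewrite mulnC exprM (prim_expr_order w_prim) expr1n.
have rK j : (j.+1 * r = (j * r + r.-1).+1)%N by rewrite mulSn; lia.
move=> lta ltb; move En : (m * r + a)%N => n.
elim: n m s a b En lta ltb => [|n IH] m s a b En lta ltb.
  have [-> ->] : m = 0%N /\ a = 0%N by nia.
  case: s => [|s]; first by rewrite add0n bin0 mul1r.
  by rewrite gauss_small ?mul0r // rK addSn.
case: a En lta => [|a] En lta.
  case: m En => [|m] En; first by move: En; rewrite mul0n.
  have {}En : (m * r + r.-1 = n)%N by move: En; rewrite rK; lia.
  case: b ltb => [|b] ltb.
    case: s => [|s]; first by rewrite !gauss0 bin0 mulr1.
    rewrite addn0 rK gaussS -rK wr mul1r -[(s.+1 * r)%N]addn0.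
    rewrite !(IH m _ r.-1) // ?prednK //; try lia.
    by rewrite gaussnn !gauss0 !mulr1 binS natrD addrC.
  rewrite addnS gaussS -addnS !(IH m _ r.-1) //; try lia.
  rewrite exprD wr mul1r mulrCA -mulrDr -gaussS prednK; last by lia.
  by rewrite gauss_root_order ?mulr0.
have {}En : (m * r + a = n)%N by lia.
case: b ltb => [|b] ltb.
  case: s => [|s]; first by rewrite !gauss0 bin0 mulr1.
  rewrite addn0 rK gaussS -rK wr mul1r -[(s.+1 * r)%N]addn0 !(IH m _ a) //; try lia.
  by rewrite !gauss0 [gauss w a _]gauss_small ?mulr0 ?add0r //; lia.
rewrite addnS gaussS -addnS !(IH m _ a) //; try lia.
by rewrite exprD wr mul1r mulrCA -mulrDr -gaussS.
Qed.

(** When r divides n, both w^n and [n+1] are 1, so [qint_syt] leaves twice a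
    product of two Gaussian binomials, which factor by [gauss_lucas]. If k is not
    a multiple of r then one of the small factors binom(1,t), binom(r-2,r-1)
    vanishes. *)
Lemma syt_root_dvd m s t : (0 < m)%N -> (t < r)%N -> (2 <= s * r + t)%N ->
  (2 <= m * r)%N ->
  syt w (m * r) (s * r + t) =
    if t == 0%N then (2 * 'C(m, s) * 'C(m.-1, s.-1))%:R else 0.
Proof.
move=> m_gt0 lttr le2k le2n; have := qint_syt w le2n le2k.
have wr j : w ^+ (j * r) = 1 by rewrite mulnC exprM (prim_expr_order w_prim) expr1n.
have -> : qint w (m * r).+1 = 1.
  rewrite qintSr wr; have /eqP -> : qint w (m * r) == 0; last exact: add0r.
  by rewrite qint_root_eq0 dvdn_mull.
rewrite mul1r wr -(addn1 (m * r)) gauss_lucas // => ->.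
have -> : (m * r - 2 = m.-1 * r + (r - 2))%N by case: m m_gt0 {le2n}; lia.
case: eqP => [t0|/eqP t0].
  have s0 : (0 < s)%N by case: s le2k; lia.
  have -> : (s * r + t - 2 = s.-1 * r + (r - 2))%N.
    by rewrite t0 addn0; case: s s0 {le2k}; lia.
  rewrite gauss_lucas //; try lia.
  rewrite t0 addn0 mulnAC wr gauss0 gaussnn; rewrite !natrM; ring.
case: t t0 lttr le2k => [|[|t]] // _ lttr le2k; last first.
  by rewrite (gauss_small w (_ : 1 < t.+2)%N) ?mulr0 ?mul0r.
have s0 : (0 < s)%N by case: s le2k; lia.
have -> : (s * r + 1 - 2 = s.-1 * r + (r - 1))%N by case: s s0 {le2k}; lia.
rewrite gauss_lucas //; try lia.
by rewrite [gauss w (r - 2) _]gauss_small ?mulr0 //; lia.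
Qed.

(** Here w^n = -1 kills the right side of [qint_syt], while [n+1] does not vanish,
    as r would divide 2(n+1) - 2n = 2. *)
Lemma syt_root_ndvd n k : (2 <= n)%N -> (2 <= k)%N -> (2 < r)%N ->
  (r %| 2 * n)%N -> ~~ (r %| n)%N -> syt w n k = 0.
Proof.
move=> le2n le2k r_gt2 r2n rn; have := qint_syt w le2n le2k.
have -> : w ^+ n = -1.
  apply/eqP; move: r2n rn; rewrite !(prim_order_dvd w_prim) mulnC exprM.
  by rewrite sqrf_eq1 => /orP[->|].
rewrite subrr mulr0 !mul0r => /eqP; rewrite mulf_eq0 qint_root_eq0.
case/orP => [rn1|/eqP //]; exfalso.
have : (r %| 2 * n.+1 - 2 * n)%N by rewrite dvdn_sub // dvdn_mull.
have -> : (2 * n.+1 - 2 * n = 2)%N by lia.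
by move=> /dvdn_leq; lia.
Qed.

End RootOfUnity.

(** At w = -1 with n odd, [n+1] vanishes and [qint_syt] says nothing; the
    division-free form still evaluates by [gauss_lucas]. *)
Lemma syt_neg1_odd (F : fieldType) (w : F) m s (t : bool) :
  2.-primitive_root w -> (0 < m)%N -> (0 < s)%N ->
  syt w (2 * m).+1 (2 * s + t) =
    if t then 0 else ('C(m.+1, s) * 'C(m.-1, s.-1) + 'C(m, s) * 'C(m, s.-1))%:R.
Proof.
move=> w2 m_gt0 s_gt0; have L := gauss_lucas (isT : (1 < 2)%N) w2.
have wN : w = -1.
  apply/eqP; have := prim_expr_order w2 => /eqP; rewrite sqrf_eq1 => /orP[/eqP w1|//].
  by move: (prim_order_dvd w2 1); rewrite expr1 w1 eqxx.
rewrite /syt.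
have -> : ((2 * m).+2 = m.+1 * 2 + 0)%N by lia.
have -> : ((2 * m).+1 - 2 = m.-1 * 2 + 1)%N by lia.
have -> : ((2 * m).+1 - 1 = m * 2 + 0)%N by lia.
have -> : ((2 * m).+1 = m * 2 + 1)%N by lia.
have -> : (2 * s + t - 2 = s.-1 * 2 + t)%N by lia.
have -> : (2 * s + t = s * 2 + t)%N by lia.
rewrite !L //; try by case: t.
case: t; rewrite /= ?addn0 ?gauss0 ?gaussnn.
  by rewrite (gauss_small w (ltn0Sn 0)); ring.
have -> : w ^+ ((s * 2) * (s.-1 * 2)) = 1.
  by rewrite mulnAC mulnC exprM (prim_expr_order w2) expr1n.
rewrite natrD !natrM wN; ring.
Qed.

(** * Dyck words by peaks and major index *)

(** Conditions and weights are functions of sequences, so that removing the first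
    letter of a tuple gives a sum of the same shape. *)
Definition word_sum (V : nmodType) (n : nat) (P : pred (seq bool))
    (F : seq bool -> V) : V := \sum_(t : n.-tuple bool | P t) F t.

Lemma word_sum0 (V : nmodType) P (F : seq bool -> V) :
  word_sum 0 P F = if P [::] then F [::] else 0.
Proof.
rewrite /word_sum big_mkcond (big_pred1 [tuple]) // => t.
by rewrite [t]tuple0 /= eqxx.
Qed.

Lemma word_sumS (V : nmodType) n P (F : seq bool -> V) :
  word_sum n.+1 P F = word_sum n (P \o cons true) (F \o cons true)
                    + word_sum n (P \o cons false) (F \o cons false).
Proof.
pose f (x : bool * n.-tuple bool) := [tuple of x.1 :: x.2].
pose f' (t : n.+1.-tuple bool) := (thead t, [tuple of behead t]).
rewrite /word_sum (reindex f) /=; last first.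
  exists f' => [[b t] _|t _]; rewrite /f /f' /=.
    by congr (_, _); apply: val_inj.
  by rewrite [RHS]tuple_eta; apply: val_inj.
transitivity (\sum_b \sum_(t : n.-tuple bool | P (b :: t)) F (b :: t)).
  by rewrite pair_big_dep.
by rewrite big_bool.
Qed.

Lemma eq_word_sum (V : nmodType) n (P P' : pred (seq bool)) (F F' : seq bool -> V) :
  (forall s, size s = n -> P s = P' s) ->
  (forall s, size s = n -> P s -> F s = F' s) ->
  word_sum n P F = word_sum n P' F'.
Proof.
move=> eP eF; apply: eq_big => t; first by rewrite eP ?size_tuple.
by apply: eF; rewrite size_tuple.
Qed.

Lemma word_sum_pred0 (V : nmodType) n (P : pred (seq bool)) (F : seq bool -> V) :
  (forall s, size s = n -> P s = false) -> word_sum n P F = 0.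
Proof. by move=> P0; rewrite /word_sum big_pred0 // => t; rewrite P0 ?size_tuple. Qed.

Lemma card_words n (P : pred (seq bool)) :
  #|[set t : n.-tuple bool | P t]| = word_sum n P (fun=> 1%N).
Proof. by rewrite -sum1dep_card. Qed.

(** The letter true is an up step; the path starts at height h, ends at 0 and
    stays non-negative. Dyck words are the case h = 0. *)
Fixpoint ballot (h : nat) (s : seq bool) : bool :=
  match s, h with
  | [::], _ => h == 0
  | true :: s', _ => ballot h.+1 s'
  | false :: s', 0 => false
  | false :: s', h'.+1 => ballot h' s'
  end.

(** The same paths, but reaching height 0 only at the very end. *)
Fixpoint strict_ballot (h : nat) (s : seq bool) : bool :=
  match h, s with
  | 0, _ => nilp s
  | _.+1, [::] => false
  | h'.+1, true :: s' => strict_ballot h.+1 s'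
  | h'.+1, false :: s' => strict_ballot h' s'
  end.

(** Non-empty Dyck words that are not a product of two non-empty ones. In terms of
    matchings, the first point is matched with the last one. *)
Definition prime_word (s : seq bool) : bool :=
  if s is x :: s' then x && strict_ballot 1 s' else false.

(** Here and in [comaj], x is the letter that precedes the word. *)
Fixpoint peaks (x : bool) (s : seq bool) : nat :=
  if s is y :: s' then ((x && ~~ y) + peaks y s')%N else 0.

(** A peak weighs the number of letters after its up step. For Dyck words this is
    the major index of the reversed path; weights read from the right end suit a
    recursion on the first letter. *)
Fixpoint comaj (x : bool) (s : seq bool) : nat :=
  if s is y :: s' then ((x && ~~ y) * size s + comaj y s')%N else 0.

(** A peak may straddle the end of the word. *)
Definition circ_peaks (s : seq bool) : nat :=
  if s is x :: s' then peaks x (rcons s' x) else 0.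

Lemma strict_ballotW h s : strict_ballot h s -> ballot h s.
Proof.
elim: s h => [|[] s IH] [|h] //=.
- exact: IH.
- exact: IH.
Qed.

Lemma prime_word_ballot s : prime_word s -> ballot 0 s.
Proof. by case: s => [|[] s] //= /strict_ballotW. Qed.

Lemma ballot_size h s : ballot h s -> (h <= size s)%N.
Proof.
elim: s h => [|[] s IH] h /=; first by move/eqP->.
  by move/IH; lia.
by case: h => // h /IH.
Qed.

Lemma ballot_last h x s : ballot h s -> (0 < size s)%N || ~~ x -> last x s = false.
Proof.
elim: s h x => [|y s IH] h x /=; first by case: x.
case: y => Hb _; first by apply: (IH h.+1) => //; have := ballot_size Hb; lia.
by case: h Hb => // h Hb; apply: (IH h) => //; rewrite orbT.
Qed.

Lemma peaks_rcons x s y : peaks x (rcons s y) = (peaks x s + (last x s && ~~ y))%N.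
Proof. by elim: s x => [|z s IH] x /=; rewrite ?addn0 ?add0n // IH addnA. Qed.

Lemma comaj_rcons x s y :
  comaj x (rcons s y) = (comaj x s + peaks x s + (last x s && ~~ y))%N.
Proof.
elim: s x => [|z s IH] x /=; first by rewrite muln1 addn0.
rewrite IH size_rcons; lia.
Qed.

Section Ballot.
Variables (R : comNzRingType) (q : R).
Local Notation E := (ballot_gauss q).

Lemma ballot_gaussk0 a b : E a b 0 = (b == 0%N)%:R.
Proof.
rewrite /ballot_gauss mul0n expr0 mul1r.
by case: b => [|b]; rewrite !gauss0 mulr1 ?subr0 ?subrr.
Qed.

Lemma ballot_gauss_b0 a k : E a 0 k = (k == 0%N)%:R.
Proof.
case: k => [|k]; rewrite ?ballot_gaussk0 // /ballot_gauss.
by rewrite (gauss_small q (ltn0Sn k)) mulr0 subr0 mulr0.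
Qed.

Lemma ballot_gauss_diag b k : E b b.+1 k = 0.
Proof. by rewrite /ballot_gauss mulrC [X in _ - X]mulrC subrr mul0r. Qed.

(** Each difference is a single Gaussian binomial by [gaussS_right]; this is the
    ballot recursion for words without the ballot condition. *)
Lemma gauss_mixed_difference a b k :
  q ^+ (k.+1 * k.+1) * ((gauss q a.+1 k.+1 - gauss q a k.+1)
    * (gauss q b.+1 k.+1 - gauss q b k.+1))
  = q ^+ (a + b).+1 * (q ^+ (k * k) * (gauss q a k * gauss q b k)).
Proof.
rewrite !gaussS_right ![_ + _ * _]addrC !addrK.
have [ltak|leka] := ltnP a k; first by rewrite (gauss_small _ ltak) !(mulr0, mul0r).
have [ltbk|lekb] := ltnP b k; first by rewrite (gauss_small _ ltbk) !(mulr0, mul0r).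
rewrite mulrACA !mulrA -!exprD; congr (_ ^+ _ * _ * _); lia.
Qed.

Lemma ballot_gauss_rec a b k :
  E a.+1 b.+1 k.+1 - E a b.+1 k.+1
  = E a.+1 b k.+1 - E a b k.+1 + q ^+ (a + b).+1 * E a b k.
Proof.
have D1 := gauss_mixed_difference a b k.
rewrite /ballot_gauss; case: b D1 => [|b] D1.
  rewrite !subr0 -D1 (gauss_small q (ltn0Sn k)); ring.
have D2 := gauss_mixed_difference a.+1 b k.
rewrite (_ : a.+1 + b = a + b.+1)%N in D2; last by lia.
rewrite !mulrBr -{}D1 -{}D2; ring.
Qed.

Definition ballot_sum (x : bool) (h k n : nat) : R :=
  word_sum n (fun s => ballot h s && (peaks x s == k)) (fun s => q ^+ comaj x s).

Lemma ballot_sum_false h k n :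
  ballot_sum false h k n.+1 =
  ballot_sum true h.+1 k n + (if h is h'.+1 then ballot_sum false h' k n else 0).
Proof.
rewrite /ballot_sum word_sumS; congr (_ + _).
by case: h => [|h] //; rewrite word_sum_pred0.
Qed.

Lemma ballot_sum_true h k n :
  ballot_sum true h k n.+1 = ballot_sum true h.+1 k n +
  (if (h, k) is (h'.+1, k'.+1) then q ^+ n.+1 * ballot_sum false h' k' n else 0).
Proof.
rewrite /ballot_sum word_sumS; congr (_ + _).
case: h => [|h]; first by rewrite word_sum_pred0.
case: k => [|k]; first by rewrite word_sum_pred0 // => s _ /=; rewrite andbF.
rewrite /word_sum mulr_sumr; apply: eq_bigr => t _ /=.
by rewrite mul1n size_tuple exprD.
Qed.

Lemma ballot_sum_high x h k n : (n < h)%N -> ballot_sum x h k n = 0.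
Proof.
move=> ltnh; rewrite /ballot_sum word_sum_pred0 // => s sn.
by apply/negP => /andP[/ballot_size]; lia.
Qed.

(** The two sums satisfy the same recursion on the first letter as the closed
    forms. Here b is the number of up steps, so the word has h + b down steps. *)
Lemma ballot_sumE n h b k : n = (h + b + b)%N ->
  ballot_sum false h k n = E (h + b) b k /\
  ((0 < h + b)%N ->
     ballot_sum true h k n = E (h + b) b.+1 k - E (h + b).-1 b.+1 k).
Proof.
elim: n h b k => [|n IH] h b k nhb.
  have [-> ->] : h = 0%N /\ b = 0%N by lia.
  by split=> //; rewrite ballot_gauss_b0 /ballot_sum word_sum0 /=; case: k.
have IHt : ballot_sum true h.+1 k n =
    if b is b'.+1 then E (h + b) b k - E (h + b).-1 b k else 0.
  case: b nhb => [|b] nhb; first by rewrite ballot_sum_high //; lia.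
  have [_ ->] := IH h.+1 b k ltac:(lia); last by lia.
  by rewrite addSn addnS.
have IHf h' k' : h = h'.+1 -> ballot_sum false h' k' n = E (h' + b) b k'.
  by move=> hh'; have [->] := IH h' b k' ltac:(lia).
split=> [|_].
  rewrite ballot_sum_false IHt; case: h b nhb IHf {IHt} => [|h] [|b] nhb IHf //.
  - by rewrite add0n ballot_gauss_diag subr0 addr0.
  - by rewrite IHf // !ballot_gauss_b0 add0r.
  - by rewrite IHf // addSn subrK.
rewrite ballot_sum_true IHt; case: k {IHt} IHf => [|k] IHf.
  rewrite !ballot_gaussk0; case: h nhb {IHf} => [|h] nhb; case: b nhb => [|b] nhb;
    by rewrite ?subrr ?addr0.
case: h b nhb IHf => [|h] [|b] nhb IHf //.
- rewrite !add0n /= addr0 [RHS]ballot_gauss_rec !(ballot_gauss_diag b).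
  by rewrite mulr0 addr0.
- rewrite IHf // addn0 add0r /= [RHS]ballot_gauss_rec !ballot_gauss_b0 subrr add0r.
  by congr (q ^+ _ * _).
- rewrite IHf // addSn /= [RHS]ballot_gauss_rec; congr (_ + q ^+ _ * _); lia.
Qed.

End Ballot.

(** The last step of a path that reaches 0 only at the end is a down step from
    height 1; before it the path, lowered by one, is a ballot path. *)
Lemma word_sum_rcons (V : nmodType) n h (F : seq bool -> V) :
  word_sum n.+1 (strict_ballot h.+1) F
  = word_sum n (ballot h) (fun s => F (rcons s false)).
Proof.
elim: n h F => [|n IH] h F.
  by rewrite word_sumS !word_sum0 /=; case: h => [|h]; rewrite add0r.
rewrite word_sumS [RHS]word_sumS; congr (_ + _).
  by rewrite IH.
case: h => [|h]; last by rewrite IH.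
rewrite [LHS]word_sum_pred0 => [|s]; last by case: s.
by rewrite [RHS]word_sum_pred0.
Qed.

Lemma word_sum_prime (V : nmodType) n (F : seq bool -> V) :
  word_sum n.+2 prime_word F
  = word_sum n (ballot 0) (fun s => F (true :: rcons s false)).
Proof.
rewrite word_sumS [X in _ + X]word_sum_pred0 // addr0.
exact: (word_sum_rcons n 0 (F \o cons true)).
Qed.

(** The number of short edges of the matching of a Dyck word, by
    [card_short_edges]. *)
Definition cyclic_peaks (s : seq bool) : nat := (peaks false s + prime_word s)%N.

(** Each Dyck word contributes a power of q to q^n Syt(n,k;q), for k its number
    of cyclic peaks. This gives the coefficients of Syt(n,k;q) in one stroke with
    the number of matchings, at q = 1. *)
Lemma dyck_sum (R : comNzRingType) (q : R) n k : (2 <= n)%N -> (2 <= k)%N ->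
  word_sum (2 * n) (fun s => ballot 0 s && (cyclic_peaks s == k))
    (fun s => q ^+ comaj false s) = q ^+ n * syt q n k.
Proof.
move=> le2n le2k; rewrite syt_ballot //.
have D m j : ballot_gauss q m m j = ballot_sum q false 0 j (2 * m).
  have e : (2 * m = 0 + m + m)%N by lia.
  by have [<- _] := ballot_sumE q j e.
rewrite !D.
have Dprime j : word_sum (2 * n) (fun s => prime_word s && (peaks false s == j))
    (fun s => q ^+ comaj false s) = q ^+ j * ballot_sum q false 0 j (2 * n.-1).
  have -> : (2 * n = (2 * n.-1).+2)%N by lia.
  transitivity (word_sum (2 * n.-1).+2 prime_word
     (fun s => if peaks false s == j then q ^+ comaj false s else 0)).
    by rewrite /word_sum -big_mkcondr.
  rewrite word_sum_prime /ballot_sum /word_sum mulr_sumr [RHS]big_mkcondr.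
  apply: eq_bigr => t bt.
  have t0 : (0 < size t)%N by rewrite size_tuple; lia.
  have lt : last true t = false by apply: ballot_last bt _; rewrite t0.
  rewrite /= peaks_rcons comaj_rcons lt addn0.
  case: t bt t0 {lt} => [[|[] s] //= _] bt _; rewrite !add0n addn0.
  by case: eqP => // ->; rewrite exprD mulrC.
have mk P (F : seq bool -> R) :
    word_sum (2 * n) P F = \sum_(t : (2 * n).-tuple bool) if P t then F t else 0.
  by rewrite /word_sum big_mkcond.
rewrite -!Dprime /ballot_sum !mk -sumrB -big_split.
apply: eq_bigr => t _ /=; rewrite /cyclic_peaks.
have [/prime_word_ballot -> /=|_ /=] := boolP (prime_word t); last first.
  by rewrite addn0 subr0 addr0.
by rewrite addn1 subrr add0r -(prednK (ltnW le2k)).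
Qed.

Local Open Scope nat_scope.

(** * Circular words by peaks *)

(** Cutting a circular word after its first letter leaves a linear word framed by
    that letter on both sides, with the same peaks. The letter z on the right stays
    fixed while x follows the recursion; A counts the letters true in between. *)
Definition framed_count (x z : bool) (A k n : nat) : nat :=
  word_sum n (fun s => (count id s == A) && (peaks x (rcons s z) == k)) (fun=> 1%N).

Lemma framed_count0 x z A k :
  framed_count x z A k 0 = (A == 0) && (k == (x && ~~ z)).
Proof. by rewrite /framed_count word_sum0 /= addn0 (eq_sym A) (eq_sym k); case: ifP. Qed.

Lemma framed_countS x z A k n :
  framed_count x z A k n.+1 =
    (if A is A'.+1 then framed_count true z A' k n else 0)
  + (if x then (if k is k'.+1 then framed_count false z A k' n else 0)
     else framed_count false z A k n).
Proof.
rewrite /framed_count word_sumS; congr (_ + _).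
  case: A => [|A]; first by rewrite word_sum_pred0.
  by apply: eq_word_sum => // s _; rewrite /= andbF.
case: x; last by apply: eq_word_sum.
case: k => [|k]; first by rewrite word_sum_pred0 // => s _ /=; rewrite andbF.
by apply: eq_word_sum.
Qed.

Lemma framed_count_big x z A k n : n < A -> framed_count x z A k n = 0.
Proof.
move=> ltnA; rewrite /framed_count word_sum_pred0 // => s sn.
by have := count_size id s; case: eqP => //=; lia.
Qed.

Lemma framed_count_up n A B k : n = A + B ->
  framed_count false true A k n = 'C(A, k) * 'C(B, k) /\
  framed_count true true A k n =
    if B is B'.+1 then (if k is k'.+1 then 'C(A.+1, k) * 'C(B', k') else 0)
    else (k == 0).
Proof.
elim: n A B k => [|n IH] A B k nAB.
  have [-> ->] : A = 0 /\ B = 0 by lia.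
  by rewrite !framed_count0; case: k.
have IHt A' k' : A = A'.+1 -> framed_count true true A' k' n =
    if B is B'.+1 then (if k' is k''.+1 then 'C(A, k') * 'C(B', k'') else 0)
    else (k' == 0).
  by move=> eA; have [|_ ->] := IH A' B k' _; [lia | rewrite eA].
have IHf k' : framed_count false true A k' n =
    if B is B'.+1 then 'C(A, k') * 'C(B', k') else 0.
  case: B nAB {IHt} => [|B'] nAB; first by rewrite framed_count_big //; lia.
  by have [|->] := IH A B' k' _; first by lia.
rewrite !framed_countS !IHf.
have -> : (if A is A'.+1 then framed_count true true A' k n else 0) =
   if A is A'.+1 then
     (if B is B'.+1 then (if k is k''.+1 then 'C(A, k) * 'C(B', k'') else 0)
      else (k == 0))
   else 0.
  by case: A IHt {nAB IHf} => // A' IHt; rewrite IHt.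
by split; case: A nAB {IHt} IHf => [|A]; case: B => [|B]; case: k => [|k] nAB IHf //=;
  rewrite ?IHf ?bin0n ?bin0 ?binS ?bin0n /= ?bin0n; nia.
Qed.

Lemma framed_count_down n A B k : n = A + B ->
  framed_count true false A k n = (if k is k'.+1 then 'C(A, k') * 'C(B, k') else 0) /\
  framed_count false false A k n =
    if A is A'.+1 then (if k is k'.+1 then 'C(A', k') * 'C(B.+1, k) else 0)
    else (k == 0).
Proof.
elim: n A B k => [|n IH] A B k nAB.
  have [-> ->] : A = 0 /\ B = 0 by lia.
  by rewrite !framed_count0; case: k => [|[|k]].
have IHf k' : framed_count false false A k' n =
    if B is B'.+1 then (if A is A'.+1 then
      (if k' is k''.+1 then 'C(A', k'') * 'C(B, k') else 0) else (k' == 0)) else 0.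
  case: B nAB => [|B'] nAB; first by rewrite framed_count_big //; lia.
  by have [|_ ->] := IH A B' k' _; first by lia.
rewrite !framed_countS !IHf.
have -> : (if A is A'.+1 then framed_count true false A' k n else 0) =
   if A is A'.+1 then (if k is k'.+1 then 'C(A', k') * 'C(B, k') else 0) else 0.
  case: A nAB {IHf} => // A' nAB; by have [|->] := IH A' B k _; first by lia.
by split; case: A nAB IHf => [|A]; case: B => [|B]; case: k => [|[|k]] nAB IHf //=;
  rewrite ?IHf ?bin0n ?bin0 ?binS ?bin0n /= ?bin0n ?bin0; nia.
Qed.

(** The two terms count the words that begin with true and with false. *)
Lemma card_circ_peaks p A B k : p = A.+1 + B.+1 ->
  #|[set t : p.-tuple bool | (count id t == A.+1) && (circ_peaks t == k.+1)]|
  = 'C(A.+1, k.+1) * 'C(B, k) + 'C(A, k) * 'C(B.+1, k.+1).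
Proof.
move=> ->.
rewrite (card_words _ (fun s => (count id s == A.+1) && (circ_peaks s == k.+1))).
rewrite addSn word_sumS; congr (_ + _).
  have [_ /= <-] := framed_count_up k.+1 (erefl (A + B.+1)); exact: eq_word_sum.
have e : A + B.+1 = A.+1 + B by lia.
have [_ /= <-] := framed_count_down k.+1 e; exact: eq_word_sum.
Qed.

(** * Letters, arcs and first returns *)

(** Windows of an infinite word, rather than finite words, since a rotation is
    then a shift of the window. *)
Definition ups (w : pred nat) (a l : nat) : nat := count w (iota a l).

Lemma ups0 w a : ups w a 0 = 0. Proof. by []. Qed.
Lemma upsS w a l : ups w a l.+1 = w a + ups w a.+1 l. Proof. by []. Qed.
Lemma upsD w a l1 l2 : ups w a (l1 + l2) = ups w a l1 + ups w (a + l1) l2.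
Proof. by rewrite /ups iotaD count_cat. Qed.
Lemma upsSr w a l : ups w a l.+1 = ups w a l + w (a + l).
Proof. by rewrite -addn1 upsD /ups /= addn0. Qed.
Lemma eq_ups w w' a l :
  (forall x, a <= x < a + l -> w x = w' x) -> ups w a l = ups w' a l.
Proof. by move=> e; apply: eq_in_count => x; rewrite mem_iota => /e. Qed.
Lemma ups_shift w a b l : ups (fun x => w (a + x)) b l = ups w (a + b) l.
Proof. by rewrite /ups iotaDl count_map. Qed.

Lemma ups_downs w a l : count (predC w) (iota a l) + ups w a l = l.
Proof. by rewrite addnC /ups count_predC size_iota. Qed.

Lemma leq_count_in (P Q : pred nat) (f : nat -> nat) (s t : seq nat) :
  uniq s -> {in s &, forall x y, P x -> P y -> f x = f y -> x = y} ->
  (forall x, x \in s -> P x -> (f x \in t) && Q (f x)) -> count P s <= count Q t.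
Proof.
move=> us injf sub; rewrite -!size_filter -(size_map f).
apply: uniq_leq_size; last first.
  move=> y /mapP[x]; rewrite mem_filter => /andP[Px xs] ->.
  by have /andP[ft Qf] := sub x xs Px; rewrite mem_filter Qf.
rewrite map_inj_in_uniq ?filter_uniq // => x y.
by rewrite !mem_filter => /andP[Px xs] /andP[Py ys]; apply: injf.
Qed.

Lemma count_pairing (P : pred nat) (f : nat -> nat) (s : seq nat) : uniq s ->
  (forall x, x \in s -> [/\ f x \in s, f (f x) = x & P (f x) = ~~ P x]) ->
  count (predC P) s = count P s.
Proof.
move=> us pair.
have half (Q : pred nat) : (forall x, x \in s -> Q (f x) = ~~ Q x) ->
    count Q s <= count (predC Q) s.
  move=> Qf; apply: (@leq_count_in _ _ f) => // [x y xs ys _ _ e|x xs Qx].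
    by have [_ <- _] := pair x xs; have [_ <- _] := pair y ys; rewrite e.
  by have [-> _ _] := pair x xs; rewrite /= Qf // Qx.
apply/eqP; rewrite eqn_leq [X in _ && X]half ?andbT => [|x /pair[]//].
rewrite -[X in _ <= X](eq_count (a1 := predC (predC P))) => [|x]; last exact: negbK.
by apply: half => x /pair[_ _ /= ->].
Qed.

(** In a proper prefix of an arc every false letter has its partner earlier in
    the prefix, and the partner of the first letter lies beyond it. With
    [arc_total] this says that f a is the first return of the path that starts
    at a, so that the word determines f. *)
Lemma arc_prefix (w : pred nat) (f : nat -> nat) a t :
  f a = a + t -> 0 < t ->
  (forall x, a <= x < a + t ->
     [/\ a <= f x, f (f x) = x, f x != x & w x = (x < f x)]) ->
  forall s, 0 < s <= t -> s < 2 * ups w a s.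
Proof.
move=> fa t0 arc s /andP[s0 lest].
have wa : w a by have [|_ _ _ ->] := arc a; lia.
case: s s0 lest => // s _ lest.
have dn : count (predC w) (iota a s.+1) <= ups w a.+1 s.
  apply: (@leq_count_in _ _ f); first exact: iota_uniq.
    move=> x y; rewrite !mem_iota => xs ys _ _ e.
    have [|_ ex _ _] := arc x; first lia.
    have [|_ ey _ _] := arc y; first lia.
    by rewrite -ex e ey.
  move=> x; rewrite mem_iota /= => xs.
  have [|lef ex nex wx] := arc x; first lia.
  rewrite wx mem_iota => nwx.
  have fxa : f x != a by apply/eqP => e; move: fa; rewrite -e ex; lia.
  by have [|_ _ _ ->] := arc (f x); [lia | rewrite ex; lia].
have := ups_downs w a s.+1; rewrite upsS wa; lia.
Qed.

Lemma arc_total (w : pred nat) (f : nat -> nat) a t :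
  (forall x, a <= x <= a + t ->
     [/\ a <= f x <= a + t, f (f x) = x, f x != x & w x = (x < f x)]) ->
  2 * ups w a t.+1 = t.+1.
Proof.
move=> arc; have pair := @count_pairing w f (iota a t.+1) (iota_uniq _ _).
have := ups_downs w a t.+1; rewrite {}pair => [|x]; first by rewrite /ups; lia.
rewrite mem_iota => xs; have [|b ff ne wx] := arc x; first lia.
have [|_ _ _ wf] := arc (f x); first lia.
by rewrite mem_iota ff wf ff wx; split; lia.
Qed.

Definition dyck (w : pred nat) (a l : nat) : Prop :=
  (forall s, s <= l -> s <= 2 * ups w a s) /\ l = 2 * ups w a l.

(** A non-crossing perfect matching of the window, where w marks the smaller ends. *)
Definition nc_mate (w : pred nat) (f : nat -> nat) (a l : nat) : Prop :=
  (forall x, a <= x < a + l ->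
     [/\ a <= f x < a + l, f (f x) = x, f x != x & w x = (x < f x)]) /\
  (forall x y, a <= x < a + l -> x < y < f x -> x < f y < f x).

(** Strong induction: the first letter is matched at the first return t, and the
    windows below and after this arc are shorter Dyck words. *)
Lemma dyck_nc_mate w a l : dyck w a l -> exists f, nc_mate w f a l.
Proof.
elim/ltn_ind: l a => l IH a [pre tot].
case: l => [|l] in IH pre tot *; first by exists id; split=> *; lia.
have wa : w a by have := pre 1 isT; rewrite upsS ups0; case: (w a).
have ex : exists s, (0 < s <= l.+1) && (s == 2 * ups w a s).
  by exists l.+1; rewrite -tot eqxx leqnn.
have [s /andP[/andP[s0 lesl] /eqP es] mins] := ex_minnP ex.
case: s s0 lesl es mins => // t _ lesl es mins.
have pos s : 0 < s <= t -> s < 2 * ups w a s.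
  move=> st; have := pre s; have := mins s; case: eqP => [e|ne]; last by lia.
  by rewrite andbT => H _; have := H ltac:(lia); lia.
have t0 : 0 < t.
  by case: t es {lesl mins pos} => //; rewrite upsS ups0 wa.
have wt : w (a + t) = false.
  have := pos t; rewrite upsSr in es; case: (w (a + t)) es => //; lia.
have [f1 [f1P f1nc]] : exists f, nc_mate w f a.+1 t.-1.
  apply: IH; first lia.
  split=> [s les|].
    by have := pos s.+1; rewrite upsS wa; lia.
  case: t t0 es wt {lesl mins pos} => // t _ es wt /=.
  move: es; rewrite upsSr upsS wa wt; lia.
have [f2 [f2P f2nc]] : exists f, nc_mate w f (a + t.+1) (l - t).
  apply: IH; first lia.
  split=> [s les|].
    have := pre (t.+1 + s); rewrite upsD; lia.
  by have := tot; rewrite (_ : l.+1 = t.+1 + (l - t)) ?upsD; lia.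
pose g x := if x == a then a + t else if x == a + t then a
            else if x < a + t then f1 x else f2 x.
have ga : g a = a + t by rewrite /g eqxx.
have gt : g (a + t) = a by rewrite /g eqxx; case: eqP => // ->.
have g1 x : a < x < a + t -> g x = f1 x.
  by move=> xb; rewrite /g; do 2 (case: eqP => [?|_]; first lia); case: ltnP; lia.
have g2 x : a + t < x -> g x = f2 x.
  by move=> xb; rewrite /g; do 2 (case: eqP => [?|_]; first lia); case: ltnP; lia.
exists g; split=> [x xl|x y xl].
  have [->|xa] := eqVneq x a; first by rewrite ga gt wa; split; lia.
  have [->|xt] := eqVneq x (a + t); first by rewrite gt ga wt; split; lia.
  case: (ltnP x (a + t)) => xat.
    have [|H1 H2 H3 ->] := f1P x; first lia.
    by rewrite (g1 x) ?(g1 (f1 x)) ?H2; try split; lia.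
  have [|H1 H2 H3 ->] := f2P x; first lia.
  by rewrite (g2 x) ?(g2 (f2 x)) ?H2; try split; lia.
have [->|xa] := eqVneq x a.
  rewrite ga => yb; rewrite g1 //.
  by have [|H1 _ _ _] := f1P y; lia.
have [->|xt] := eqVneq x (a + t); first by rewrite gt; lia.
case: (ltnP x (a + t)) => xat.
  have [|H1 H2 H3 _] := f1P x; first lia.
  by rewrite g1; [move=> yb; rewrite g1; [apply: f1nc|] | ]; lia.
have [|H1 H2 H3 _] := f2P x; first lia.
by rewrite g2; [move=> yb; rewrite g2; [apply: f2nc|] | ]; lia.
Qed.

Lemma ballotP h s : reflect
  ((forall l, l <= size s -> l <= h + 2 * ups (nth false s) 0 l) /\
   size s = h + 2 * ups (nth false s) 0 (size s)) (ballot h s).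
Proof.
elim: s h => [|x s IH] h /=.
  by apply: (iffP eqP) => [->|[_]]; [split=> // l; rewrite leqn0 => /eqP-> | lia].
have upsx l : ups (nth false (x :: s)) 0 l.+1 = x + ups (nth false s) 0 l.
  by rewrite upsS -[1]addn0 -ups_shift.
case: x upsx => upsx.
  apply: (iffP (IH _)) => -[pre tot]; split.
  - by case=> // l lel; rewrite upsx; have := pre l lel; lia.
  - by rewrite upsx; lia.
  - by move=> l lel; have := pre l.+1 lel; rewrite upsx; lia.
  - by move: tot; rewrite upsx; lia.
case: h => [|h].
  by constructor=> -[pre _]; have := pre 1 isT; rewrite upsx ups0.
apply: (iffP (IH _)) => -[pre tot]; split.
- by case=> // l lel; rewrite upsx; have := pre l lel; lia.
- by rewrite upsx; lia.
- by move=> l lel; have := pre l.+1 lel; rewrite upsx; lia.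
- by move: tot; rewrite upsx; lia.
Qed.

(** In every prefix the false letters inject into the true ones. *)
Lemma dyck_of_pairing (w : pred nat) (f : nat -> nat) l :
  (forall x, x < l -> [/\ f x < l, f (f x) = x, w (f x) = ~~ w x & w x || (f x < x)]) ->
  dyck w 0 l.
Proof.
move=> pair; split=> [s les|].
  have : count (predC w) (iota 0 s) <= count w (iota 0 s).
    apply: (@leq_count_in _ _ f); first exact: iota_uniq.
      move=> x y; rewrite !mem_iota => xs ys _ _ e.
      have [|_ <- _ _] := pair x; first lia.
      by have [|_ <- _ _] := pair y; [lia | rewrite e].
    move=> x; rewrite !mem_iota /= => xs nwx; have [|_ _ -> lt] := pair x; first lia.
    by move: lt; rewrite (negPf nwx) /=; lia.
  by have := ups_downs w 0 s; rewrite /ups; lia.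
have := ups_downs w 0 l; rewrite (@count_pairing w f _ (iota_uniq _ _)).
  by rewrite /ups; lia.
by move=> x; rewrite !mem_iota /= add0n => /pair[].
Qed.

Lemma ballot_dyck s : reflect (dyck (nth false s) 0 (size s)) (ballot 0 s).
Proof. by apply: (iffP (ballotP 0 s)). Qed.

Lemma strict_ballotP h s : reflect
  ((forall l, l < size s -> l < h.+1 + 2 * ups (nth false s) 0 l) /\
   size s = h.+1 + 2 * ups (nth false s) 0 (size s)) (strict_ballot h.+1 s).
Proof.
elim: s h => [|x s IH] h; first by constructor=> -[_] /=; lia.
have upsx l : ups (nth false (x :: s)) 0 l.+1 = x + ups (nth false s) 0 l.
  by rewrite upsS -[1]addn0 -ups_shift.
case: x upsx => upsx.
  apply: (iffP (IH _)) => /= -[pre tot]; split.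
  - by case=> // l lel; rewrite upsx; have := pre l lel; lia.
  - by rewrite upsx; lia.
  - by move=> l lel; have := pre l.+1 lel; rewrite upsx; lia.
  - by move: tot; rewrite upsx; lia.
case: h => [|h] /=.
  have -> : strict_ballot 0 s = nilp s by case: (s).
  apply: (iffP nilP) => [->|[pre _]]; first by split=> // -[].
  by case: s {IH upsx} pre => // x s pre; have := pre 1 isT.
apply: (iffP (IH _)) => -[pre tot]; split.
- by case=> // l lel; rewrite upsx; have := pre l lel; lia.
- by rewrite upsx; lia.
- by move=> l lel; have := pre l.+1 lel; rewrite upsx; lia.
- by move: tot; rewrite upsx; lia.
Qed.

(** * Non-crossing matchings as involutions *)

Definition ncm (m : nat) (M : {set {set 'I_m}}) : bool :=
  perfect_matching M && ~~ crossing M.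

(** The default value i is not reached when M is a perfect matching. *)
Definition mate (m : nat) (M : {set {set 'I_m}}) (i : 'I_m) : 'I_m :=
  odflt i [pick j | (j != i) && ([set i; j] \in M)].

Definition matching_of (m : nat) (f : 'I_m -> 'I_m) : {set {set 'I_m}} :=
  [set [set i; f i] | i : 'I_m].

(** For an involution, this one-sided condition is already the absence of
    crossings: of two crossing edges, the one with the smallest end violates it. *)
Definition ncinv (m : nat) (f : 'I_m -> 'I_m) : Prop :=
  [/\ involutive f, forall i, f i != i &
      forall a b : 'I_m, a < b < f a -> a < f b < f a].

Section Mate.
Variable m : nat.
Implicit Types (M : {set {set 'I_m}}) (i j : 'I_m) (f : 'I_m -> 'I_m).

Lemma set2_inj i j k : [set i; j] = [set i; k] -> j = k.
Proof.
move=> e; have : j \in [set i; k] by rewrite -e !inE eqxx orbT.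
have : k \in [set i; j] by rewrite e !inE eqxx orbT.
by rewrite !inE => /orP[]/eqP ek /orP[]/eqP ej; congruence.
Qed.

Lemma mem_mate M i : perfect_matching M ->
  mate M i != i /\ [set i; mate M i] \in M.
Proof.
case/andP=> /and3P[/eqP cov _ _] /forall_inP M2.
rewrite /mate; case: pickP => [j /andP[] //|none]; exfalso.
have : i \in cover M by rewrite cov inE.
case/bigcupP=> e eM ie; have /cards2P[x [y [nxy exy]]] := M2 e eM.
move: ie; rewrite exy !inE => /orP[]/eqP ei; subst i.
  by have := none y; rewrite eq_sym nxy -exy eM.
by have := none x; rewrite nxy setUC -exy eM.
Qed.

Lemma mate_eq M i j : perfect_matching M -> i != j -> [set i; j] \in M -> mate M i = j.
Proof.
move=> pM nij ijM; have [_ mM] := mem_mate i pM.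
case/andP: pM => /and3P[_ /trivIsetP tr _] _.
have [/set2_inj //|ne] := eqVneq [set i; mate M i] [set i; j].
have := tr _ _ mM ijM ne; rewrite -setI_eq0 => /eqP/setP/(_ i).
by rewrite !inE eqxx.
Qed.

Lemma mateK M : perfect_matching M -> involutive (mate M).
Proof.
move=> pM i; have [ne iM] := mem_mate i pM.
by apply: mate_eq => //; rewrite setUC.
Qed.

Lemma matching_of_mate M : perfect_matching M -> matching_of (mate M) = M.
Proof.
move=> pM; apply/setP => e; apply/imsetP/idP => [[i _ ->]|eM].
  by have [] := mem_mate i pM.
have := pM; case/andP => _ /forall_inP/(_ e eM)/cards2P[x [y [nxy exy]]].
by exists x => //; rewrite (mate_eq pM nxy) -?exy.
Qed.

Lemma mem_matching_of f i j : involutive f ->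
  i != j -> ([set i; j] \in matching_of f) = (f i == j).
Proof.
move=> fK nij; apply/imsetP/eqP => [[k _ e]|<-]; last by exists i.
have : k \in [set i; j] by rewrite e !inE eqxx.
rewrite !inE => /orP[]/eqP ek; subst k; first by rewrite (set2_inj e).
by move: e; rewrite setUC => /set2_inj ->; rewrite fK.
Qed.

Lemma perfect_matching_of f : involutive f -> (forall i, f i != i) ->
  perfect_matching (matching_of f).
Proof.
move=> fK fne; apply/andP; split.
  apply/and3P; split.
  - apply/eqP/setP => i; rewrite inE; apply/bigcupP.
    by exists [set i; f i]; rewrite ?inE ?eqxx //; apply/imsetP; exists i.
  - apply/trivIsetP => A B /imsetP[i _ ->] /imsetP[j _ ->].
    apply: contraNT => /pred0Pn[x /andP[/=]]; rewrite !inE => xi xj.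
    have E y k : (y == k) || (y == f k) -> [set k; f k] = [set y; f y].
      by case/orP=> /eqP->; rewrite // fK setUC.
    by rewrite (E x i) // (E x j).
  - apply/imsetP => -[i _ /setP/(_ i)]; by rewrite !inE eqxx.
by apply/forall_inP => e /imsetP[i _ ->]; rewrite cards2 (eq_sym i) fne.
Qed.

Lemma mate_matching_of f : involutive f -> (forall i, f i != i) ->
  mate (matching_of f) =1 f.
Proof.
move=> fK fne i; apply: mate_eq; first exact: perfect_matching_of.
  by rewrite eq_sym.
by apply/imsetP; exists i.
Qed.

Lemma crossingP M : perfect_matching M ->
  reflect (forall a b : 'I_m, a < b < mate M a -> a < mate M b < mate M a)
          (~~ crossing M).
Proof.
move=> pM; have mK := mateK pM.
have chord (a c : 'I_m) : a < c -> ([set a; c] \in M) = (mate M a == c).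
  move=> ltac; rewrite -{1}(matching_of_mate pM) mem_matching_of //.
  by rewrite -(inj_eq val_inj) /=; lia.
have noX (a b c d : 'I_m) : ~~ crossing M -> a < b -> b < c -> c < d ->
    mate M a = c -> mate M b = d -> False.
  move=> /negP nX ab bc cd ma mb; apply: nX.
  apply/existsP; exists a; apply/existsP; exists b; apply/existsP; exists c.
  apply/existsP; exists d; rewrite ab bc cd !chord; try lia.
  by rewrite ma mb !eqxx.
apply: (iffP idP) => [nX a b /andP[ab bma]|nc].
  have [nma _] := mem_mate b pM.
  have nba : mate M b != a :> nat.
    by apply/eqP => /val_inj e; move: bma; rewrite -e mK ltnn.
  have nbma : mate M b != mate M a :> nat.
    by apply/eqP => /val_inj /(can_inj mK) e; move: ab; rewrite e ltnn.
  rewrite -(inj_eq val_inj) /= in nma.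
  apply/andP; split; rewrite ltnNge; apply/negP => le.
    by apply: (@noX (mate M b) a b (mate M a)) => //; rewrite ?mK //; lia.
  by apply: (@noX a b (mate M a) (mate M b)) => //; lia.
apply/negP => /existsP[a /existsP[b /existsP[c /existsP[d]]]].
case/and5P => ab bc cd; rewrite !chord; try lia.
move=> /eqP ma /eqP mb; have := nc a b; rewrite ma mb; lia.
Qed.

Lemma ncm_perfect M : ncm M -> perfect_matching M. Proof. by case/andP. Qed.

Lemma ncm_ncinv M : ncm M -> ncinv (mate M).
Proof.
case/andP=> pM nX; split; [exact: mateK | | exact/(crossingP pM)].
by move=> i; have [] := mem_mate i pM.
Qed.

Lemma ncinv_ncm f : ncinv f -> ncm (matching_of f).
Proof.
case=> fK fne fnc; have pM := perfect_matching_of fK fne.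
apply/andP; split=> //; apply/(crossingP pM) => a b.
by rewrite !mate_matching_of //; apply: fnc.
Qed.

Lemma eq_mate M M' : perfect_matching M -> perfect_matching M' ->
  mate M =1 mate M' -> M = M'.
Proof.
move=> pM pM' e; rewrite -(matching_of_mate pM) -(matching_of_mate pM').
by apply: eq_imset => i; rewrite e.
Qed.

Lemma smaller_endpointE M i : perfect_matching M ->
  smaller_endpoint M i = (i < mate M i).
Proof.
move=> pM; apply/existsP/idP => [[j /andP[ij ijM]]|].
  by rewrite (mate_eq pM _ ijM) // -(inj_eq val_inj) /=; lia.
by exists (mate M i); have [_ ->] := mem_mate i pM; rewrite andbT.
Qed.

Lemma rot_matching_of f : involutive f ->
  rot_matching (matching_of f) = matching_of (@ordS m \o f \o @ord_pred m).
Proof.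
move=> fK; rewrite /rot_matching /matching_of -imset_comp.
apply/setP => e; apply/imsetP/imsetP => -[i _ ->] /=.
  exists (ordS i) => //; rewrite /= ordSK.
  by rewrite imsetU1 imset_set1.
by exists (ord_pred i) => //; rewrite imsetU1 imset_set1 ord_predK.
Qed.

Lemma ordS_val i : ordS i = (if i.+1 == m then 0 else i.+1) :> nat.
Proof.
rewrite /=; case: eqP => [->|ne]; first by rewrite modnn.
by rewrite modn_small //; have := ltn_ord i; lia.
Qed.

Lemma rot_ncinv f : ncinv f -> ncinv (@ordS m \o f \o @ord_pred m).
Proof.
case=> fK fne fnc; split=> [i|i|a b].
- by rewrite /= ordSK fK ord_predK.
- by rewrite /= -{2}(ord_predK i) (inj_eq (@ordS_inj m)).
have [[a' ->] [b' ->]] : (exists a', a = ordS a') /\ (exists b', b = ordS b').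
  by split; [exists (ord_pred a) | exists (ord_pred b)]; rewrite ord_predK.
have g (i : 'I_m) : (@ordS m \o f \o @ord_pred m) (ordS i) = ordS (f i).
  by rewrite /= ordSK.
rewrite !g !ordS_val.
have h1 := fnc a' b'; have := fnc b' (f a'); rewrite fK => h2.
have h3 : nat_of_ord (f b') = a' -> nat_of_ord b' = f a'.
  by move/val_inj <-; rewrite fK.
have h4 : nat_of_ord (f b') = f a' -> nat_of_ord b' = a'.
  by move/val_inj/(can_inj fK) ->.
have := ltn_ord a'; have := ltn_ord b'; have := ltn_ord (f a'); have := ltn_ord (f b').
by do 4 (case: eqP => ?); lia.
Qed.

Lemma rot_ncm M : ncm M -> ncm (rot_matching M).
Proof.
move=> nM; rewrite -(matching_of_mate (ncm_perfect nM)) rot_matching_of.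
  exact/ncinv_ncm/rot_ncinv/ncm_ncinv.
exact/mateK/ncm_perfect.
Qed.

Lemma mate_rot M i : perfect_matching M ->
  mate (rot_matching M) (ordS i) = ordS (mate M i).
Proof.
move=> pM; rewrite -{1}(matching_of_mate pM) (rot_matching_of (mateK pM)).
rewrite mate_matching_of /= ?ordSK // => [j|j] /=.
  by rewrite ordSK mateK // ord_predK.
rewrite -{2}(ord_predK j) (inj_eq (@ordS_inj m)).
by have [] := mem_mate (ord_pred j) pM.
Qed.

Lemma iter_ordS p i : iter p (@ordS m) i = (i + p) %% m :> nat.
Proof.
elim: p => [|p IH]; first by rewrite addn0 modn_small.
by rewrite iterS /= IH addnS -[in LHS]addn1 -[in RHS]addn1 modnDml.
Qed.

Lemma iter_ordS_m i : iter m (@ordS m) i = i.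
Proof. by apply: val_inj; rewrite /= iter_ordS addnC modnDl modn_small. Qed.

Lemma iter_rot_ncm p M : ncm M -> ncm (iter p (@rot_matching m) M).
Proof. by move=> nM; elim: p => //= p; apply: rot_ncm. Qed.

Lemma mate_iter_rot p M i : ncm M ->
  mate (iter p (@rot_matching m) M) (iter p (@ordS m) i) = iter p (@ordS m) (mate M i).
Proof.
move=> nM; elim: p => //= p IH.
by rewrite mate_rot ?IH //; apply/ncm_perfect/iter_rot_ncm.
Qed.

Lemma iter_rot_m M : iter m (@rot_matching m) M = M.
Proof.
have E p : iter p (@rot_matching m) M
    = [set [set iter p (@ordS m) i | i in e] | e : {set 'I_m} in M].
  elim: p => [|p IH].
    rewrite /= -[LHS]imset_id; apply: eq_imset => e.
    by rewrite -[LHS]imset_id.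
  rewrite iterS IH /rot_matching -imset_comp; apply: eq_imset => e.
  by rewrite /= -imset_comp.
rewrite E -[RHS]imset_id; apply: eq_imset => e.
rewrite -[RHS]imset_id; apply: eq_imset => i; exact: iter_ordS_m.
Qed.

End Mate.

(** * Matchings and Dyck words *)

(** The involution on points, as a function on all natural numbers. *)
Definition extend (m : nat) (f : 'I_m -> 'I_m) (x : nat) : nat :=
  if insub x is Some i then val (f i) else x.

Lemma extendE m (f : 'I_m -> 'I_m) (i : 'I_m) : extend f i = f i.
Proof. by rewrite /extend valK. Qed.

Lemma extend_lt m (f : 'I_m -> 'I_m) x (ltxm : x < m) :
  extend f x = f (Ordinal ltxm).
Proof. by rewrite -extendE. Qed.

Lemma ncm_of_nat N (F : nat -> nat) :
  (forall y, y < N -> [/\ F y < N, F (F y) = y & F y != y]) ->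
  (forall y z, y < N -> y < z < F y -> y < F z < F y) ->
  exists2 M : {set {set 'I_N}}, ncm M &
    forall i : 'I_N, mate M i = F i :> nat.
Proof.
move=> FP Fnc; have Fm (i : 'I_N) : F i < N by have [] := FP i (ltn_ord i).
pose g i := Ordinal (Fm i).
have ng : ncinv g.
  split=> [i|i|a b] /=.
  - by apply: val_inj; have [] := FP i (ltn_ord i).
  - by rewrite -(inj_eq val_inj); have [] := FP i (ltn_ord i).
  - exact: (Fnc a b (ltn_ord a)).
exists (matching_of g); first exact: ncinv_ncm.
by move=> i; have [gK gne _] := ng; rewrite mate_matching_of.
Qed.

Definition opener_word (m : nat) (M : {set {set 'I_m}}) : m.-tuple bool :=
  [tuple i < mate M i | i < m].

Section Linear.
Variable m : nat.
Implicit Types (M : {set {set 'I_m}}) (i j : 'I_m).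

Lemma nth_opener_word M i : nth false (opener_word M) i = (i < mate M i).
Proof. by rewrite -tnth_nth tnth_mktuple. Qed.

Lemma nth_opener_word_nat M x : x < m ->
  nth false (opener_word M) x = (x < extend (mate M) x).
Proof.
by move=> ltxm; rewrite (extend_lt _ ltxm) -(nth_opener_word M (Ordinal ltxm)).
Qed.

Lemma mate_val_neq M i : ncm M -> mate M i != i :> nat.
Proof. by case/ncm_ncinv => _ ne _; rewrite (inj_eq val_inj). Qed.

(** The arc of an opening point satisfies the hypotheses of [arc_total]. *)
Lemma mate_arc M i x : ncm M -> i < mate M i -> i <= x <= mate M i ->
  let f := extend (mate M) in
  [/\ i <= f x <= mate M i, f (f x) = x, f x != x &
      nth false (opener_word M) x = (x < f x)].
Proof.
move=> nM lti xb f; have [fK fne fnc] := ncm_ncinv nM.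
have ltxm : x < m by have := ltn_ord (mate M i); lia.
rewrite nth_opener_word_nat // {}/f.
rewrite -[x]/(val (Ordinal ltxm)) in xb *.
move: (Ordinal ltxm) xb => {ltxm}j xb; rewrite !extendE fK mate_val_neq //; split=> //.
have [->|ji] := eqVneq j i; first lia.
have [->|jm] := eqVneq j (mate M i); first by rewrite fK; lia.
have := fnc i j; move: ji jm xb; rewrite -!(inj_eq val_inj) /=; lia.
Qed.

(** The edge of an opening point ends at the first return of the word. *)
Lemma opener_word_inj M M' :
  ncm M -> ncm M' -> opener_word M = opener_word M' -> M = M'.
Proof.
have half (N N' : {set {set 'I_m}}) i : ncm N -> ncm N' ->
    opener_word N = opener_word N' -> i < mate N i -> mate N i <= mate N' i.
  move=> nN nN' e lti; rewrite leqNgt; apply/negP => lt.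
  have lti' : i < mate N' i by rewrite -nth_opener_word -e nth_opener_word.
  pose t := mate N' i - i.
  have eq : 2 * ups (nth false (opener_word N')) i t.+1 = t.+1.
    apply: (@arc_total _ (extend (mate N'))) => x.
    by rewrite subnKC; [apply: mate_arc | lia].
  have := @arc_prefix (nth false (opener_word N)) (extend (mate N)) i (mate N i - i).
  rewrite extendE subnKC; last lia.
  move/(_ erefl ltac:(lia)) => H.
  have {H} := H _ t.+1; rewrite e eq => H.
  suff : t.+1 < t.+1 by rewrite ltnn.
  apply: H; last by rewrite /t; lia.
  move=> x xb; have xb' : i <= x <= mate N i by lia.
  by rewrite -e; have [/andP[]] := mate_arc nN lti xb'.
move=> nM nM' e; have [fK _ _] := ncm_ncinv nM; have [fK' _ _] := ncm_ncinv nM'.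
apply: eq_mate; try exact: ncm_perfect.
have up i : i < mate M i -> mate M i = mate M' i.
  move=> lti; apply/val_inj/eqP; rewrite /= eqn_leq !half //.
  by rewrite -nth_opener_word -e nth_opener_word.
move=> i; case: (ltnP i (mate M i)) => [/up //|le].
have : mate M i < mate M (mate M i) by rewrite fK; have := mate_val_neq i nM; lia.
by move/up => eM; apply: (can_inj fK'); rewrite -eM fK fK'.
Qed.

Lemma dyck_ncm (t : m.-tuple bool) : ballot 0 t -> exists2 M, ncm M & opener_word M = t.
Proof.
move/ballot_dyck; rewrite size_tuple => /dyck_nc_mate[f [fP fnc]].
have fl x : x < m -> [/\ f x < m, f (f x) = x & f x != x] by case/fP.
have [M nM mM] := ncm_of_nat fl fnc; exists M => //; apply: eq_from_tnth => i.
by rewrite tnth_mktuple mM (tnth_nth false); have [_ _ _ ->] := fP i (ltn_ord i).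
Qed.

Lemma opener_word_ballot M : ncm M -> ballot 0 (opener_word M).
Proof.
move=> nM; have [fK _ _] := ncm_ncinv nM; pose f := extend (mate M).
have fE x : x < m -> [/\ f x < m, f (f x) = x, f x != x
    & nth false (opener_word M) x = (x < f x)].
  move=> ltxm; rewrite nth_opener_word_nat // -/f (_ : x = Ordinal ltxm) //.
  by rewrite /f !extendE fK mate_val_neq.
apply/ballot_dyck; rewrite size_tuple; apply: (dyck_of_pairing (f := f)) => x ltxm.
have [f1 f2 f3 wx] := fE x ltxm; have [_ _ _ wf] := fE (f x) f1.
by split; rewrite ?wf ?wx ?f2 //; lia.
Qed.

(** If i opens and i+1 closes, the edge of i+1 cannot leave the arc of i. *)
Lemma adjacent_mate M i j : ncm M -> j = i.+1 :> nat ->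
  (mate M i == j) = (i < mate M i) && ~~ (j < mate M j).
Proof.
move=> nM ji; have [fK _ fnc] := ncm_ncinv nM.
have nj := mate_val_neq j nM; have ni := mate_val_neq i nM.
apply/eqP/andP => [ej|[lti gej]]; first by rewrite -ej fK ej; lia.
apply/eqP; apply: contraLR gej => ne; rewrite negbK.
have := fnc i j; move: ne; rewrite -(inj_eq val_inj) /=; lia.
Qed.

(** An edge {i, i+1} has only one such i because there are more than two points. *)
Lemma short_edges M : 2 < m -> perfect_matching M ->
  #|[set e in M | short_edge e]| = #|[set i | mate M i == ordS i]|.
Proof.
move=> m2 pM; have mK := mateK pM.
have ordS2 i : ordS i != i /\ ordS (ordS i) != i.
  rewrite -!(inj_eq (@ord_inj m)) !ordS_val; have lti := ltn_ord i.
  have [e|ne] := eqVneq i.+1 m; last have [e|ne2] := eqVneq i.+2 m; last by split; lia.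
    by rewrite ifN; [split | ]; lia.
  by split; lia.
have -> : [set e in M | short_edge e]
    = [set [set i; ordS i] | i in [set i | mate M i == ordS i]].
  apply/setP => e; rewrite inE; apply/andP/imsetP => [[eM /existsP[i /eqP ei]]|[i]].
    exists i => //; rewrite inE; apply/eqP/mate_eq; rewrite -?ei //.
    by rewrite eq_sym; case: (ordS2 i).
  rewrite inE => /eqP mi ->; split; last by apply/existsP; exists i.
  by rewrite -mi; case: (mem_mate i pM).
apply: card_in_imset => i j _ _ e.
have : i \in [set j; ordS j] by rewrite -e !inE eqxx.
rewrite !inE => /orP[/eqP //|/eqP ij]; subst i.
by move: e; rewrite [RHS]setUC => /set2_inj e; have [_] := ordS2 j; rewrite e eqxx.
Qed.

End Linear.

Lemma peaks_sum x s :
  peaks x s = \sum_(i < size s) (nth false (x :: s) i && ~~ nth false s i).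
Proof.
by elim: s x => [|y s IH] x; rewrite ?big_ord0 //= big_ord_recl /= IH.
Qed.

Lemma circ_peaks_sum s :
  circ_peaks s = \sum_(i < size s) (nth false s i && ~~ nth false s (i.+1 %% size s)).
Proof.
case: s => [|x s]; first by rewrite big_ord0.
rewrite /circ_peaks peaks_sum size_rcons; apply: eq_bigr => i _.
have lti := ltn_ord i; congr (nat_of_bool (_ && ~~ _)).
  by case: (nat_of_ord i) lti => //= j; rewrite ltnS nth_rcons => ->.
rewrite nth_rcons /=; case: ltngtP => [lt|gt|->]; last by rewrite modnn.
  by rewrite modn_small.
by move: lti; lia.
Qed.

Lemma card_set_sum m (P : pred 'I_m) : #|[set i | P i]| = \sum_(i < m) P i.
Proof.
by rewrite -sum1dep_card big_mkcond; apply: eq_bigr => i _; case: (P i).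
Qed.

(** Both sides say that the path stays positive between its ends. *)
Lemma mate_last m (M : {set {set 'I_m.+1}}) : 0 < m -> ncm M ->
  (mate M ord_max == ordS ord_max) = prime_word (opener_word M).
Proof.
move=> m0 nM; have [fK fne _] := ncm_ncinv nM.
have -> : ordS ord_max = ord0 :> 'I_m.+1.
  by apply: ord_inj; rewrite ordS_val /= eqxx.
have -> : (mate M ord_max == ord0) = (mate M ord0 == ord_max).
  by apply/eqP/eqP => <-; rewrite fK.
have w0 : nth false (opener_word M) 0.
  by rewrite (nth_opener_word M ord0) lt0n; apply: (fne ord0).
have := opener_word_ballot nM; have sz := size_tuple (opener_word M).
have lt0 : 0 < mate M ord0 by rewrite lt0n; apply: (fne ord0).
have arc x : x <= mate M ord0 ->
  [/\ extend (mate M) x <= mate M ord0, extend (mate M) (extend (mate M) x) = x,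
      extend (mate M) x != x & nth false (opener_word M) x = (x < extend (mate M) x)].
  exact: (@mate_arc _ M ord0 x nM lt0).
case et : (tval (opener_word M)) sz w0 arc => [|[] s] //= [sz] _ arc /ballotP[_ tot].
have upsx l : ups (nth false (true :: s)) 0 l.+1 = 1 + ups (nth false s) 0 l.
  by rewrite upsS -(ups_shift _ 1 0).
apply/eqP/strict_ballotP => [e|[pre _]].
  have pos l : 0 < l <= m -> l < 2 * ups (nth false (true :: s)) 0 l.
    apply: (@arc_prefix _ (extend (mate M))) => // [|x xb].
      by rewrite (extendE _ (ord0 : 'I_m.+1)) e.
    by have [|*] := arc x; rewrite ?e /=; [lia | split].
  by split=> // l ltl; have := pos l.+1; rewrite upsx; lia.
have eq : 2 * ups (nth false (true :: s)) 0 (mate M ord0).+1 = (mate M ord0).+1.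
  exact: (@arc_total _ (extend (mate M))).
apply: val_inj => /=; have := ltn_ord (mate M ord0).
move: eq; rewrite upsx; have := pre (mate M ord0); rewrite sz; lia.
Qed.

Lemma card_short_edges m (M : {set {set 'I_m}}) : 2 < m -> ncm M ->
  #|[set e in M | short_edge e]| = cyclic_peaks (opener_word M).
Proof.
case: m M => // m M m2 nM; rewrite short_edges ?ncm_perfect // card_set_sum.
rewrite big_ord_recr mate_last //; last by lia.
rewrite /cyclic_peaks peaks_sum size_tuple big_ord_recl /= add0n; congr (_ + _).
apply: eq_bigr => i _ /=; congr nat_of_bool.
pose j : 'I_m.+1 := lift ord0 i.
have ej : ordS (widen_ord (leqnSn m) i) = j.
  by apply: ord_inj; rewrite ordS_val /= eqSS ltn_eqF.
rewrite ej (adjacent_mate nM) //.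
by rewrite -(nth_opener_word M (widen_ord _ i)) -(nth_opener_word M j).
Qed.

(** * Chords seen from the centre *)

Lemma modn_twice x N : x < 2 * N -> x %% N = if x < N then x else x - N.
Proof.
move=> ltx; case: ltnP => [|le]; first exact: modn_small.
by rewrite -{1}(subnK le) modnDr modn_small //; lia.
Qed.

(** The clockwise distance from a point to its partner. As a periodic function of
    all natural numbers it has no special behaviour at the point 0, and a rotation
    translates its argument. *)
Definition gap (m : nat) (M : {set {set 'I_m}}) (x : nat) : nat :=
  let y := x %% m in let z := extend (mate M) y in
  if y < z then z - y else z + m - y.

(** The last clause says that edges do not cross: the partner of a point x + s
    under the clockwise arc of x is under this arc too, either further on or
    further back. *)
Definition gap_function (N : nat) (g : nat -> nat) : Prop :=
  [/\ forall x, 0 < g x < N, forall x, g (x + N) = g x,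
      forall x, g (x + g x) = N - g x &
      forall x s, 0 < s < g x -> g (x + s) < g x - s \/ N - s < g (x + s)].

Section Gap.
Variables (m : nat) (M : {set {set 'I_m}}).
Hypotheses (m_gt0 : 0 < m) (nM : ncm M).

Lemma gap_ord (i : 'I_m) :
  gap M i = if i < mate M i then mate M i - i else mate M i + m - i.
Proof. by rewrite /gap modn_small // extendE. Qed.

Lemma gap_mod x : gap M (x %% m) = gap M x.
Proof. by rewrite /gap modn_mod. Qed.

Lemma ordinal_mod x : exists i : 'I_m, x %% m = i.
Proof. by exists (Ordinal (ltn_pmod x m_gt0)). Qed.

Lemma gap_mate (i : 'I_m) x : x %% m = i -> (x + gap M x) %% m = mate M i.
Proof.
move=> xi; rewrite -modnDml -gap_mod xi gap_ord.
have := ltn_ord i; have := ltn_ord (mate M i); have := mate_val_neq i nM => ne lt1 lt2.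
by case: ltnP => lt; rewrite modn_twice; try lia; case: ltnP; lia.
Qed.

Lemma gapP : gap_function m (gap M).
Proof.
have [fK _ fnc] := ncm_ncinv nM; split.
- move=> x; rewrite -gap_mod; have [i ->] := ordinal_mod x; rewrite gap_ord.
  have := ltn_ord i; have := ltn_ord (mate M i); have := mate_val_neq i nM.
  by case: (ltnP i (mate M i)); lia.
- by move=> x; rewrite -gap_mod modnDr gap_mod.
- move=> x; have [i xi] := ordinal_mod x.
  rewrite -gap_mod (gap_mate xi) -(gap_mod x) xi !gap_ord fK.
  have := ltn_ord i; have := ltn_ord (mate M i); have := mate_val_neq i nM.
  by case: (ltnP i (mate M i)); case: (ltnP (mate M i) i); lia.
move=> x s; have [i xi] := ordinal_mod x; have [j xsj] := ordinal_mod (x + s).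
rewrite -(gap_mod x) -(gap_mod (x + s)) xi xsj !gap_ord.
move: xsj; rewrite -modnDml xi => xsj sb.
have := ltn_ord i; have := ltn_ord (mate M i); have := mate_val_neq i nM.
have := ltn_ord j; have := ltn_ord (mate M j); have := mate_val_neq j nM.
move=> j1 j2 j3 i1 i2 i3.
have sm : s < m by move: sb; case: ifP; lia.
rewrite modn_twice in xsj; last lia.
have h1 := fnc i j; have := fnc (mate M i) (mate M j); rewrite !fK => h2.
have h3 : nat_of_ord (mate M j) = i -> nat_of_ord (mate M i) = j.
  by move/val_inj <-; rewrite fK.
have h4 : nat_of_ord (mate M j) = mate M i -> nat_of_ord j = i.
  by move/val_inj/(can_inj fK) ->.
move: xsj sb; case: ltnP => ? xsj; case: (ltnP i) => ? sb; case: (ltnP j) => ?; lia.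
Qed.

End Gap.

(** The partner of a point y of the clockwise arc of x, as a point of that arc. *)
Definition arc_mate (N : nat) (g : nat -> nat) (x y : nat) : nat :=
  if y + g y <= x + g x then y + g y else y + g y - N.

Section GapTheory.
Variables (N p : nat) (g : nat -> nat).
Hypotheses (gP : gap_function N g) (g_per : forall x, g (x + p) = g x).
Hypotheses (p_gt0 : 0 < p) (le_2p_N : 2 * p <= N).

Lemma gap_arc x y : x <= y <= x + g x ->
  let f := arc_mate N g x in
  [/\ x <= f y <= x + g x, f (f y) = y, f y != y &
   (y < f y /\ g y = f y - y) \/ (f y < y /\ g y = N - (y - f y))].
Proof.
case: gP => g0 gN g1 g2 yb f.
have fb : (y + g y <= x + g x /\ f y = y + g y) \/
          (x + g x < y + g y /\ x + N <= y + g y /\ f y = y + g y - N).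
  rewrite /f /arc_mate; case: leqP => le; [by left | right; split=> //; split=> //].
  have [->|ne] := eqVneq y (x + g x).
    by rewrite g1; have := g0 x; lia.
  have nyx : y != x by apply/eqP => e; rewrite e ltnn in le.
  have xy : 0 < y - x < g x by lia.
  by have := g2 x (y - x) xy; rewrite subnKC; lia.
have gy := g0 y; have gx := g0 x.
have gfy : g (f y) = N - g y.
  case: fb => [[_ ->]|[_ [le ->]]]; first exact: g1.
  by rewrite -[LHS]gN subnK ?g1 //; lia.
have ffy : f (f y) = y.
  by rewrite {1}/f /arc_mate gfy; case: fb => [[? ->]|[? [? ->]]]; case: leqP; lia.
by split=> //; case: fb => [[? ->]|[? [? ->]]]; try lia; by [left; lia | right; lia].
Qed.

(** An edge that spans more than p in both directions crosses its own rotation. *)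
Lemma gap_dichotomy x : g x <= p \/ N - p <= g x.
Proof.
case: gP => g0 _ _ g2; case: (leqP (g x) p) => [|lt]; [by left | right].
have := g2 x p; rewrite g_per; have := g0 x; lia.
Qed.

Lemma gap_diameter x : g x = p -> N = 2 * p.
Proof. by case: gP => _ _ g1 _ gx; have := g1 x; rewrite gx g_per gx; lia. Qed.

(** By [gap_dichotomy] and [gap_diameter], g x <= p means that the clockwise arc
    of x does not go around the centre, or that x is on a diameter. *)
Definition opens (x : nat) : bool := g x <= p.

Lemma opens_per x : opens (x + p) = opens x.
Proof. by rewrite /opens g_per. Qed.

(** If x opens and x + 1 does not, the edge of x + 1 runs backwards out of x + 1
    and cannot end strictly under the arc of x. *)
Lemma gap_short x : 2 < N -> (g x == 1) = opens x && ~~ opens x.+1.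
Proof.
case: gP => g0 _ g1 g2 N3; rewrite /opens -(addn1 x).
apply/eqP/andP => [gx|[le nle]].
  have g1x := g1 x; rewrite gx in g1x; rewrite gx g1x; split; lia.
have := g2 x 1; have := g0 x; have := g0 (x + 1); lia.
Qed.

Lemma opens_arc x y : g x <= p -> x <= y < x + g x ->
  [/\ x <= arc_mate N g x y, arc_mate N g x (arc_mate N g x y) = y,
      arc_mate N g x y != y & opens y = (y < arc_mate N g x y)].
Proof.
move=> gx yb; have yb' : x <= y <= x + g x by lia.
have [b1 b2 b3 b4] := gap_arc yb'; split=> //; first by lia.
by rewrite /opens; case: b4 => -[]; lia.
Qed.

Lemma opens_closed_arc x y : g x < p -> x <= y <= x + g x ->
  [/\ x <= arc_mate N g x y <= x + g x, arc_mate N g x (arc_mate N g x y) = y,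
      arc_mate N g x y != y & opens y = (y < arc_mate N g x y)].
Proof.
move=> gx yb; have [b1 b2 b3 b4] := gap_arc yb; split=> //.
by rewrite /opens; case: b4 => -[]; lia.
Qed.

Lemma arc_mate_start x : arc_mate N g x x = x + g x.
Proof. by rewrite /arc_mate leqnn. Qed.

Lemma opens_prefix x s : g x <= p -> 0 < s <= g x -> s < 2 * ups opens x s.
Proof.
move=> gx; apply: (arc_prefix (arc_mate_start x)); first by case: gP => /(_ x); lia.
by move=> y; apply: opens_arc.
Qed.

Lemma opens_arc_total x : g x < p -> 2 * ups opens x (g x).+1 = (g x).+1.
Proof.
by move=> gx; apply: (arc_total (f := arc_mate N g x)) => y; apply: opens_closed_arc.
Qed.

End GapTheory.

(** As in [opener_word_inj], the arc of an opening point ends at its first return.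
    The end of a diameter is an opening point with no return within p steps. *)
Lemma opens_inj N p g g' : gap_function N g -> gap_function N g' ->
  (forall x, g (x + p) = g x) -> (forall x, g' (x + p) = g' x) ->
  0 < p -> 2 * p <= N -> (forall x, opens p g x = opens p g' x) -> g =1 g'.
Proof.
move=> gP gP' per per' p0 pN e.
have half h h' x : gap_function N h -> gap_function N h' ->
    (forall x, opens p h x = opens p h' x) -> h x <= p -> h x <= h' x.
  move=> hP hP' eh hx; rewrite leqNgt; apply/negP => lt.
  have hx' : h' x < p by lia.
  have := opens_prefix hP p0 pN hx (s := (h' x).+1) ltac:(lia).
  by rewrite (eq_ups (w' := opens p h')) ?(opens_arc_total hP' p0 pN hx') ?ltnn.
have op x : g x <= p -> g x = g' x.
  move=> gx; have gx' : g' x <= p by move: (e x); rewrite /opens gx => <-.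
  by apply/eqP; rewrite eqn_leq (half g g' x) ?(half g' g x).
move=> x; case: (leqP (g x) p) => [/op //|gt].
case: (gP) => g0 gN g1 _; case: (gP') => _ gN' g1' _.
have gz := g1 x; have [|ge] := gap_dichotomy gP per p0 pN x; first lia.
have := op (x + g x); rewrite gz => H.
have {}H := H ltac:(lia).
have := g1' (x + g x); rewrite -H (_ : x + g x + (N - g x) = x + N).
  by rewrite gN' => ->; have := g0 x; lia.
by have := g0 x; lia.
Qed.

Lemma ups_period w p a : (forall x, w (x + p) = w x) -> ups w a p = ups w 0 p.
Proof.
move=> per; elim: a => // a IH; rewrite -IH.
have := upsS w a p; rewrite upsSr per; lia.
Qed.

Lemma ups_periodM w p r :
  (forall x, w (x + p) = w x) -> ups w 0 (r * p) = r * ups w 0 p.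
Proof.
move=> per; elim: r => // r IH.
rewrite mulSn addnC upsD IH -(@ups_period w p (0 + r * p)) //; lia.
Qed.

Lemma periodic_mod (T : Type) (h : nat -> T) p x :
  (forall x, h (x + p) = h x) -> h (x %% p) = h x.
Proof.
move=> per; rewrite {2}(divn_eq x p); elim: (x %/ p) => [|k IH]; first by rewrite mul0n.
by rewrite mulSn (addnC p) addnAC per.
Qed.

Section GapCount.
Variables (N p : nat) (g : nat -> nat).
Hypotheses (gP : gap_function N g) (g_per : forall x, g (x + p) = g x).
Hypotheses (p_gt0 : 0 < p) (le_2p_N : 2 * p <= N).
Local Notation w := (opens p g).

(** The p - 1 points strictly under one side of a diameter are matched among
    themselves, and the end x of the diameter is one more opening point. *)
Lemma ups_opens_diameter x : g x = p -> 2 * ups w 0 p = p.+1.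
Proof.
move=> gx; rewrite -(ups_period x (opens_per g_per)).
have lo : p < 2 * ups w x p by apply: (opens_prefix gP) => //; lia.
have wx : w x by rewrite /opens gx.
have p1 : p = p.-1.+1 by lia.
have up : count (predC w) (iota x.+1 p.-1) = ups w x.+1 p.-1.
  pose f := arc_mate N g x.
  have arc y : x <= y <= x + p -> [/\ x <= f y <= x + p, f (f y) = y & f y != y].
    by move=> yb; rewrite -gx in yb *; have [] := gap_arc gP p_gt0 le_2p_N yb.
  have fx : f x = x + p by rewrite /f arc_mate_start gx.
  have inner y : x < y < x + p -> x < f y < x + p.
    move=> yb; have [|fb ffy _] := arc y; first lia.
    have ne1 : f y != x by apply/eqP => e; move: ffy; rewrite e fx; lia.
    have ne2 : f y != x + p.
      by apply/eqP => e; move: ffy; rewrite e -fx; have [|_ -> _] := arc x; lia.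
    lia.
  have op y : x <= y < x + p -> w y = (y < f y).
    move=> yb; have gxp : g x <= p by rewrite gx.
    by have [|_ _ _ //] := opens_arc gP p_gt0 le_2p_N gxp (y := y); rewrite gx.
  apply: (count_pairing (f := f)) => [|y]; first exact: iota_uniq.
  rewrite !mem_iota => ys; have fyb := inner y ltac:(lia).
  have [|_ ffy ne] := arc y; first lia.
  by rewrite ffy !op ?ffy; try lia; split; lia.
have := ups_downs w x.+1 p.-1; have := upsS w x p.-1; rewrite -p1 wx; lia.
Qed.

(** Every edge that is not a diameter has exactly one opening end. *)
Lemma ups_opens_balanced r : N = r * p -> (forall x, g x != p) -> 2 * ups w 0 p = p.
Proof.
move=> Nrp nodiam; have [g0 gN g1 _] := gP.
have r0 : 0 < r by case: r Nrp; lia.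
pose f y := (y + g y) %% N.
have gf y : g (f y) = N - g y by rewrite /f (periodic_mod _ gN).
have fK y : y < N -> (f y + g (f y)) %% N = y.
  move=> yN; rewrite gf /f modnDml -addnA subnKC; last by have := g0 y; lia.
  by rewrite modnDr modn_small.
have fw y : w (f y) = ~~ w y.
  rewrite /opens gf; have := g0 y; have := nodiam y.
  by case: (gap_dichotomy gP g_per p_gt0 le_2p_N y); lia.
have fN y : f y < N by rewrite ltn_mod; have := g0 0; lia.
have half : count (predC w) (iota 0 N) = ups w 0 N.
  apply: (count_pairing (f := f)) => [|y]; first exact: iota_uniq.
  rewrite !mem_iota !add0n => ys; have ffy : f (f y) = y by apply: fK.
  by rewrite ffy fw fN.
have E := ups_periodM r (opens_per g_per); rewrite -Nrp in E.
have := ups_downs w 0 N; rewrite half.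
by move=> tot; apply/eqP; rewrite -(eqn_pmul2l r0) mulnCA -E -Nrp; lia.
Qed.

End GapCount.

(** * Matchings with a prescribed circular word *)

(** The cycle lemma: start after the last minimum of the height 2 ups - j over one
    period. *)
Lemma last_minimum_rotation (U : pred nat) p c : 0 < p -> (forall x, U (x + p) = U x) ->
  2 * ups U 0 p = p + c -> c <= 1 ->
  exists2 j, j < p & forall s, 0 < s <= p -> s + c <= 2 * ups U j s.
Proof.
move=> p0 per tot c1.
(* Lexicographic: smallest height first (raised by p to be a natural number),
   then the largest index. *)
pose phi j := (2 * ups U 0 j + (p - j)) * p.+1 + (p - j).
have [j ltj minj] : exists2 j, j < p & forall i, i < p -> phi j <= phi i.
  case: (@arg_minnP _ (Ordinal p0) xpredT (fun i : 'I_p => phi i)) => // j _ minj.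
  by exists j => // i ltip; apply: (minj (Ordinal ltip)).
exists j => // s sp.
case: (ltnP (j + s) p) => [lt|ge].
  by have := minj _ lt; rewrite /phi upsD add0n; nia.
have e1 : ups U j s = ups U j (p - j) + ups U 0 (j + s - p).
  have {1}-> : s = (p - j) + (j + s - p) by lia.
  rewrite upsD subnKC; last lia.
  congr (_ + _); have := ups_shift U p 0 (j + s - p); rewrite addn0 => <-.
  by apply: eq_ups => x _; rewrite addnC per.
have e2 : ups U 0 p = ups U 0 j + ups U j (p - j).
  by rewrite -[in RHS](add0n j) -upsD add0n subnKC // ltnW.
have [j'p|] := ltnP (j + s - p) p; last lia.
by have := minj _ j'p; rewrite /phi; nia.
Qed.

(** Invariance under the rotation by p is expressed on gaps; see [iter_rot_gap]. *)
Definition realizes (N p : nat) (V : pred nat) (M : {set {set 'I_N}}) : Prop :=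
  [/\ ncm M, forall x, gap M (x + p) = gap M x & forall x, opens p (gap M) x = V x].

Lemma realizes_of_nat N p r (V : pred nat) (F : nat -> nat) :
  0 < p -> N = r * p -> 2 <= r -> (forall x, V (x + p) = V x) ->
  (forall y, y < N -> [/\ F y < N, F (F y) = y & F y != y]) ->
  (forall y z, y < N -> y < z < F y -> y < F z < F y) ->
  (forall y, y < N -> F ((y + p) %% N) = (F y + p) %% N) ->
  (forall y, y < N -> V y = if y < F y then F y <= y + p else F y + N <= y + p) ->
  exists M : {set {set 'I_N}}, realizes p V M.
Proof.
move=> p0 Nrp r2 per FP Fnc Fper FV.
have pN : 2 * p <= N by rewrite Nrp leq_mul2r r2 orbT.
have N0 : 0 < N by lia.
have [M nM mM] := ncm_of_nat FP Fnc.
have gE y : y < N -> gap M y = if y < F y then F y - y else F y + N - y.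
  by move=> ltyN; rewrite -[y]/(val (Ordinal ltyN)) gap_ord !mM.
exists M; split=> // x.
  rewrite -(gap_mod M x) -(gap_mod M (x + p)) -modnDml.
  have yN : x %% N < N by rewrite ltn_mod.
  move: (x %% N) yN => y yN; have y'N : (y + p) %% N < N by rewrite ltn_mod.
  rewrite !gE // Fper //; have [F1 F2 F3] := FP y yN.
  rewrite !modn_twice; try lia.
  case: (ltnP (y + p)) => ?; case: (ltnP (F y + p)) => ?; case: (ltnP y (F y)) => ?;
    by case: ltnP; lia.
have perN y : V (y + N) = V y.
  by rewrite Nrp; elim: (r) => [|k IH]; rewrite ?addn0 // mulSn (addnC p) addnA per.
rewrite /opens -(gap_mod M x) -(periodic_mod x perN).
have yN : x %% N < N by rewrite ltn_mod.
by move: (x %% N) yN => y yN; rewrite FV // gE //; case: ltnP; lia.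
Qed.

(** The matching of the Dyck word V on [0, p), repeated on each of the r blocks. *)
Lemma realize_balanced N p r (V : pred nat) :
  0 < p -> N = r * p -> 2 <= r -> (forall x, V (x + p) = V x) -> dyck V 0 p ->
  exists M : {set {set 'I_N}}, realizes p V M.
Proof.
move=> p0 Nrp r2 per /dyck_nc_mate[f [fP fnc]].
have {}fP y : y < p -> [/\ f y < p, f (f y) = y, f y != y & V y = (y < f y)].
  exact: fP.
have {}fnc y z : y < p -> y < z < f y -> y < f z < f y by exact: fnc.
pose F y := (y %/ p) * p + f (y %% p).
have FE b a : a < p -> F (b * p + a) = b * p + f a.
  by move=> ap; rewrite /F divnMDl // modnMDl divn_small ?modn_small ?addn0.
have split_N y : y < N -> exists b a, [/\ y = b * p + a, a < p & b < r].
  move=> yN; exists (y %/ p), (y %% p).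
  by rewrite -divn_eq ltn_mod p0 ltn_divLR // -Nrp.
have VE b a : V (b * p + a) = V a.
  by elim: b => [|b IH]; rewrite ?mul0n // mulSn -addnA addnC per.
apply: (@realizes_of_nat N p r V F) => //.
- move=> y /split_N[b [a [-> ap br]]]; have [f1 f2 f3 _] := fP a ap.
  rewrite !FE // f2; split; [rewrite Nrp; nia | by [] | lia].
- move=> y z /split_N[b [a [-> ap br]]]; have [f1 f2 f3 _] := fP a ap.
  rewrite FE // => yz; have zp : z - b * p < p by lia.
  have -> : z = b * p + (z - b * p) by lia.
  rewrite FE //; have := fnc a (z - b * p) ap; lia.
- move=> y /split_N[b [a [-> ap br]]]; have [f1 f2 f3 _] := fP a ap.
  rewrite FE //; have [ltbr|gebr] := ltnP b.+1 r.
    rewrite !modn_small; try by rewrite Nrp; nia.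
    by rewrite addnAC -mulSnr FE // mulSnr addnAC.
  have -> : b * p + a + p = a + N by rewrite Nrp (_ : r = b.+1) ?mulSn; lia.
  have -> : b * p + f a + p = f a + N by rewrite Nrp (_ : r = b.+1) ?mulSn; lia.
  have pN : p <= N by rewrite Nrp; nia.
  by rewrite !modnDr !modn_small ?(FE 0); lia.
move=> y /split_N[b [a [-> ap br]]]; have [f1 f2 f3 f4] := fP a ap.
have pN : 2 * p <= N by rewrite Nrp; nia.
rewrite VE f4 FE // ltn_add2l; case: ltnP; lia.
Qed.

(** The points 0 and p form the diameter, and the Dyck word that follows the
    surplus letter is matched on each side of it. *)
Lemma realize_diameter N p (V : pred nat) :
  0 < p -> N = 2 * p -> (forall x, V (x + p) = V x) -> V 0 -> dyck V 1 p.-1 ->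
  exists M : {set {set 'I_N}}, realizes p V M.
Proof.
move=> p0 N2p per V0 /dyck_nc_mate[f [fP fnc]].
have {}fP y : 0 < y < p -> [/\ 0 < f y < p, f (f y) = y, f y != y & V y = (y < f y)].
  by move=> yp; have [|? ? ? ?] := fP y; [lia | split=> //; lia].
have {}fnc y z : 0 < y < p -> y < z < f y -> y < f z < f y.
  by move=> yp; apply: fnc; lia.
pose F y := if y == 0 then p else if y == p then 0
            else if y < p then f y else p + f (y - p).
have F0 : F 0 = p by [].
have Fp : F p = 0 by rewrite /F eqxx; case: eqP => //; lia.
have F1 y : 0 < y < p -> F y = f y.
  by move=> yp; rewrite /F; do 2 (case: eqP => [?|_]; first lia); case: ltnP; lia.
have F2 y : 0 < y < p -> F (p + y) = p + f y.
  move=> yp; rewrite /F; do 2 (case: eqP => [?|_]; first lia); case: ltnP; first lia.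
  by rewrite addKn.
have cases y : y < N -> [\/ y = 0, y = p, 0 < y < p | exists2 a, 0 < a < p & y = p + a].
  move=> yN; case: (ltngtP y p) => [lt|gt|->]; last by apply: Or42.
    by case: y lt yN => [|y] *; [apply: Or41 | apply: Or43].
  by apply: Or44; exists (y - p); lia.
apply: (@realizes_of_nat N p 2 V F) => //.
- move=> y /cases[->|->|yp|[a ap ->]].
  + by rewrite F0 Fp; split; lia.
  + by rewrite Fp F0; split; lia.
  + by have [f1 f2 f3 _] := fP y yp; rewrite F1 // F1 // f2; split; lia.
  + by have [f1 f2 f3 _] := fP a ap; rewrite F2 // F2 // f2; split; lia.
- move=> y z /cases[->|->|yp|[a ap ->]].
  + by rewrite F0 => zp; rewrite F1 //; have [] := fP z zp; lia.
  + by rewrite Fp; lia.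
  + have [f1 f2 f3 _] := fP y yp; rewrite F1 // => yz.
    by rewrite F1; [apply: fnc | lia].
  + have [f1 f2 f3 _] := fP a ap; rewrite F2 // => yz.
    have -> : z = p + (z - p) by lia.
    by rewrite F2; last lia; have := fnc a (z - p) ap; lia.
- move=> y /cases[->|->|yp|[a ap ->]].
  + by rewrite F0 add0n modn_small ?Fp ?addnn -?mul2n -?N2p ?modnn //; lia.
  + by rewrite Fp add0n addnn -mul2n -N2p modnn F0 modn_small //; lia.
  + have [f1 f2 f3 _] := fP y yp.
    rewrite (F1 y yp) (@modn_small (y + p)); last lia.
    by rewrite (@modn_small (f y + p)) 1?addnC ?F2 1?addnC //; lia.
  + have [f1 f2 f3 _] := fP a ap; rewrite F2 //.
    have -> : p + a + p = a + N by lia.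
    have -> : p + f a + p = f a + N by lia.
    by rewrite !modnDr !modn_small ?F1 //; lia.
move=> y /cases[->|->|yp|[a ap ->]].
- by rewrite F0 V0; case: ltnP; lia.
- by rewrite Fp (per 0) V0; case: ltnP; lia.
- by have [f1 f2 f3 ->] := fP y yp; rewrite F1 //; case: ltnP; lia.
- have [f1 f2 f3 f4] := fP a ap; rewrite F2 // addnC per f4.
  by case: (ltnP a) => ?; case: ltnP; lia.
Qed.

Lemma gap_iter_rot N (M : {set {set 'I_N}}) j x : 0 < N -> ncm M ->
  gap (iter j (@rot_matching N) M) (x + j) = gap M x.
Proof.
move=> N0 nM; rewrite -gap_mod -(gap_mod M x).
have [i xi] := ordinal_mod N0 x; rewrite -modnDml xi -iter_ordS !gap_ord.
rewrite mate_iter_rot // !iter_ordS.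
have := ltn_ord i; have := ltn_ord (mate M i); have := mate_val_neq i nM => ne lt1 lt2.
rewrite -(modnDmr i) -(modnDmr (mate M i)); have := ltn_pmod j N0.
move: (j %% N) => {}j jN; rewrite !modn_twice; try lia.
by case: (ltnP (i + j)) => ?; case: (ltnP (mate M i + j)) => ?; case: (ltnP i) => ?;
  case: ltnP; lia.
Qed.

(** The word is rotated so that one period is a Dyck word, possibly preceded by the
    surplus letter; the matching found there is rotated back. *)
Lemma realize_word N p r (U : pred nat) c : 0 < p -> N = r * p -> 2 <= r ->
  (forall x, U (x + p) = U x) -> 2 * ups U 0 p = p + c ->
  (c == 0) || (c == 1) && (r == 2) ->
  exists M : {set {set 'I_N}}, realizes p U M.
Proof.
move=> p0 Nrp r2 per tot cr.
have N0 : 0 < N by rewrite Nrp; nia.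
have [|j jp pre] := last_minimum_rotation p0 per tot; first lia.
pose V x := U (j + x).
have Vper x : V (x + p) = V x by rewrite /V addnA per.
have VE a s : ups V a s = ups U (j + a) s by rewrite /V ups_shift.
have Vtot : 2 * ups V 0 p = p + c by rewrite VE addn0 (ups_period j per).
have [M [nM gper opM]] : exists M : {set {set 'I_N}}, realizes p V M.
  case/orP: cr => [/eqP c0|/andP[/eqP c1 /eqP r2']].
    apply: (@realize_balanced N p r) => //; split; last by rewrite Vtot c0 addn0.
    by case=> // s sp; rewrite VE addn0; have := pre s.+1; rewrite c0; lia.
  have V1 : V 0.
    by have := pre 1; rewrite c1 -[j]addn0 -VE upsS ups0; case: (V 0) => //; lia.
  have VS s : ups V 0 s.+1 = (ups V 1 s).+1 by rewrite upsS V1.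
  apply: (@realize_diameter N p) => //; first by rewrite Nrp r2'.
  split=> [s sp|].
    by have := pre s.+1; rewrite -[j]addn0 -VE VS c1; lia.
  by move: Vtot; rewrite -{1}(prednK p0) VS c1; lia.
pose M' := iter j (@rot_matching N) M.
have nM' : ncm M' by apply: iter_rot_ncm.
have gE x : gap M' x = gap M (x + (N * j - j)).
  rewrite -(gap_iter_rot j _ N0 nM) -/M' -(gap_mod M' x) -addnA subnK ?leq_pmull //.
  by rewrite -[RHS]gap_mod addnC mulnC modnMDl.
exists M'; split=> // x; first by rewrite !gE addnAC gper.
have -> : opens p (gap M') x = V (x + (N * j - j)) by rewrite -opM /opens gE.
rewrite /V addnC -addnA subnK ?leq_pmull // Nrp -mulnA.
have UM y k : U (y + k * p) = U y.
  by elim: k => [|k IH]; rewrite ?addn0 // mulSnr addnA per.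
by rewrite mulnA mulnAC UM.
Qed.

(** * Matchings fixed by a rotation *)

Lemma ups_sum (P : pred nat) l : ups P 0 l = \sum_(i < l) P i.
Proof. by elim: l => [|l IH]; rewrite ?big_ord0 // upsSr big_ord_recr /= IH. Qed.

Lemma ups_nth s : ups (nth false s) 0 (size s) = count id s.
Proof. by rewrite -{3}(mkseq_nth false s) count_map. Qed.

Lemma gap_inj N (M M' : {set {set 'I_N}}) : 0 < N -> ncm M -> ncm M' ->
  gap M =1 gap M' -> M = M'.
Proof.
move=> N0 nM nM' e; apply: eq_mate; try exact: ncm_perfect.
move=> i; apply: ord_inj.
have im : i %% N = i by rewrite modn_small.
by rewrite -(gap_mate N0 nM im) e (gap_mate N0 nM' im).
Qed.

Lemma iter_rot_gap N (M : {set {set 'I_N}}) p : 0 < N -> ncm M ->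
  (iter p (@rot_matching N) M = M <-> forall x, gap M (x + p) = gap M x).
Proof.
move=> N0 nM; split=> [e x|per]; first by rewrite -{1}e gap_iter_rot.
apply: gap_inj => // [|x]; first exact: iter_rot_ncm.
have shift (M' : {set {set 'I_N}}) y : gap M' (y + N * p) = gap M' y.
  by rewrite -gap_mod addnC mulnC modnMDl gap_mod.
have xp : x + N * p = x + (N * p - p) + p by rewrite -addnA subnK ?leq_pmull.
by rewrite -[LHS]shift -[RHS]shift xp gap_iter_rot // per.
Qed.

Lemma mate_ordS N (M : {set {set 'I_N}}) (i : 'I_N) : 1 < N -> ncm M ->
  (mate M i == ordS i) = (gap M i == 1).
Proof.
move=> N1 nM; rewrite -(inj_eq (@ord_inj N)) ordS_val gap_ord.
have := ltn_ord i; have := ltn_ord (mate M i); have := mate_val_neq i nM => ne lt1 lt2.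
by case: (ltnP i (mate M i)); case: (i.+1 =P N); lia.
Qed.

Definition circular_word (p N : nat) (M : {set {set 'I_N}}) : p.-tuple bool :=
  [tuple opens p (gap M) i | i < p].

Lemma nth_circular_word p N (M : {set {set 'I_N}}) x : x < p ->
  nth false (circular_word p M) x = opens p (gap M) x.
Proof.
by move=> xp; rewrite -[x]/(val (Ordinal xp)) -tnth_nth tnth_mktuple.
Qed.

Section FixedMatchings.
Variables (n p r : nat).
Hypotheses (le2n : 2 <= n) (p_gt0 : 0 < p) (Nrp : 2 * n = r * p) (r_gt1 : 2 <= r).
Let le_2p_N : 2 * p <= 2 * n. Proof. by rewrite Nrp leq_mul2r r_gt1 orbT. Qed.

(** The surplus letter is one of the two ends of a diameter. *)
Definition admissible (t : seq bool) : bool :=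
  (2 * count id t == p) || (2 * count id t == p.+1) && (r == 2).

Lemma count_circular_word (M : {set {set 'I_(2 * n)}}) :
  count id (circular_word p M) = ups (opens p (gap M)) 0 p.
Proof.
rewrite -ups_nth size_tuple; apply: eq_ups => x /= xp.
by rewrite nth_circular_word.
Qed.

Lemma circular_word_admissible (M : {set {set 'I_(2 * n)}}) : ncm M ->
  (forall x, gap M (x + p) = gap M x) -> admissible (circular_word p M).
Proof.
move=> nM per; have gP : gap_function (2 * n) (gap M) by apply: gapP => //; lia.
rewrite /admissible count_circular_word.
have [/existsP[x /eqP gx]|nodiam] := boolP [exists i : 'I_(2 * n), gap M i == p].
  rewrite (ups_opens_diameter gP per p_gt0 le_2p_N gx) eqxx /=.
  have := gap_diameter gP per p_gt0 le_2p_N gx; rewrite Nrp => /eqP.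
  by rewrite eqn_pmul2r // => ->; rewrite orbT.
rewrite (ups_opens_balanced gP per p_gt0 le_2p_N Nrp) ?eqxx // => x.
apply: contra nodiam => gx; apply/existsP.
have [|i xi] := ordinal_mod (m := 2 * n) _ x; first lia.
by exists i; rewrite -xi gap_mod.
Qed.

Lemma short_edges_circular_word (M : {set {set 'I_(2 * n)}}) : ncm M ->
  (forall x, gap M (x + p) = gap M x) ->
  #|[set e in M | short_edge e]| = r * circ_peaks (circular_word p M).
Proof.
move=> nM per; have gP : gap_function (2 * n) (gap M) by apply: gapP => //; lia.
pose P x := opens p (gap M) x && ~~ opens p (gap M) x.+1.
have Pper x : P (x + p) = P x by rewrite /P -addSn !(opens_per per).
rewrite short_edges; [|lia|exact: ncm_perfect]; rewrite card_set_sum.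
transitivity (ups P 0 (2 * n)).
  rewrite ups_sum; apply: eq_bigr => i _; rewrite mate_ordS //; last lia.
  by rewrite (gap_short gP p_gt0 le_2p_N) //; lia.
have := ups_periodM r Pper; rewrite -Nrp => ->.
rewrite ups_sum circ_peaks_sum size_tuple; congr (_ * _).
apply: eq_bigr => i _; rewrite !nth_circular_word // ?ltn_mod //.
by rewrite (periodic_mod _ (opens_per per)).
Qed.

(** The circular word is a bijection: injective by [opens_inj], and surjective onto
    the admissible words by [realize_word]. *)
Lemma card_fixed_matchings k :
  #|[set M in NCMsh n k | iter p (@rot_matching (2 * n)) M == M]|
  = #|[set t : p.-tuple bool | admissible t && (r * circ_peaks t == k)]|.
Proof.
have N0 : 0 < 2 * n by lia.
set X := [set M in NCMsh n k | _].
have XP M : (M \in X) =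
    [&& ncm M, iter p (@rot_matching (2 * n)) M == M
      & #|[set e in M | short_edge e]| == k].
  by rewrite !inE -/(ncm M) -andbA; congr (_ && _); rewrite andbC.
have inj : {in X &, injective (@circular_word p (2 * n))}.
  move=> M M'; rewrite !XP => /and3P[nM /eqP fM _] /and3P[nM' /eqP fM' _] e.
  have perM := (iter_rot_gap p N0 nM).1 fM; have perM' := (iter_rot_gap p N0 nM').1 fM'.
  apply: gap_inj => //; apply: (opens_inj (gapP N0 nM) (gapP N0 nM') perM perM') => // x.
  rewrite -[LHS](periodic_mod x (opens_per perM)) -[RHS](periodic_mod x (opens_per perM')).
  by rewrite -!nth_circular_word ?e // ltn_mod.
rewrite -(card_in_imset inj); congr #|pred_of_set _|; apply/setP => t.
apply/imsetP/idP => [[M]|].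
  rewrite XP => /and3P[nM /eqP fM kM] ->.
  have perM := (iter_rot_gap p N0 nM).1 fM.
  by rewrite inE circular_word_admissible //= -short_edges_circular_word.
rewrite inE => /andP[adm kt].
pose U x := nth false t (x %% p).
have Uper x : U (x + p) = U x by rewrite /U modnDr.
have Utot : ups U 0 p = count id t.
  rewrite -ups_nth size_tuple; apply: eq_ups => x /= xp.
  by rewrite /U modn_small.
have [M [nM perM opM]] : exists M : {set {set 'I_(2 * n)}}, realizes p U M.
  case/orP: adm => [/eqP bal|/andP[/eqP bal r2]].
    by apply: (@realize_word _ p r U 0) => //; rewrite Utot bal addn0.
  by apply: (@realize_word _ p r U 1) => //; rewrite Utot bal addn1.
have tM : t = circular_word p M.
  apply: eq_from_tnth => i; rewrite !(tnth_nth false) nth_circular_word //.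
  by rewrite opM /U modn_small.
exists M => //; rewrite XP nM short_edges_circular_word // -tM kt andbT /=.
exact/eqP/(iter_rot_gap p N0 nM).
Qed.

End FixedMatchings.

(** * Tableaux *)

Lemma ord2P (r : 'I_2) : (r = ord0) + (r = ord_max).
Proof. by case: r => [[|[|r]] lt] //; [left | right]; apply: val_inj. Qed.

(** Turns comparisons of columns of a tableau into counts of letters in a prefix of
    its word. *)
Lemma sorted_count_lt (s : seq nat) c x : sorted ltn s -> c < size s ->
  (nth 0 s c < x) = (c < count (fun y => y < x) s).
Proof.
elim: s c => [|y s IH] c //= ys; have ss := path_sorted ys.
have big z : z \in s -> y < z.
  by apply/allP; move: ys; rewrite path_sortedE; [case/andP | exact: ltn_trans].
case: c => [|c] /= lt.
  case: (ltnP y x) => //= le.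
  rewrite add0n; apply/esym/negbTE; rewrite -eqn0Ngt -leqn0 leqNgt -has_count.
  by apply/hasPn => z /big; lia.
rewrite IH //; case: (ltnP y x) => //= le.
rewrite add0n; have -> : count (fun y => y < x) s = 0; last by [].
by apply/eqP; rewrite -leqn0 leqNgt -has_count; apply/hasPn => z /big; lia.
Qed.

Section Tableaux.
Variable n : nat.
Hypothesis le2n : 2 <= n.
Implicit Types (T : SYT n) (M : {set {set 'I_(2 * n)}}).
Local Notation N := (2 * n).

Lemma SYT_props T :
  [/\ injective (val T),
      forall r (c c' : 'I_n), c < c' -> val T (r, c) < val T (r, c') &
      forall c : 'I_n, val T (ord0, c) < val T (ord_max, c)].
Proof.
have /and3P[/injectiveP inj rows cols] := valP T; split=> // [r c c' lt|c].
  by move/forallP/(_ r)/forallP/(_ c)/forallP/(_ c')/implyP: rows; apply.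
by move/forallP/(_ c)/forallP/(_ ord0)/forallP/(_ ord_max)/implyP: cols; apply.
Qed.

Lemma SYT_surj T (i : 'I_N) : exists r c, val T (r, c) = i.
Proof.
have [inj _ _] := SYT_props T.
have [|g _ gK] := inj_card_bij inj; first by rewrite card_prod !card_ord.
by exists (g i).1, (g i).2; rewrite -surjective_pairing gK.
Qed.

Lemma in_first_rowE T r c : in_first_row T (val T (r, c)) = (r == ord0).
Proof.
have [inj _ _] := SYT_props T; apply/existsP/eqP => [[c' /eqP/inj[<-]] //|->].
by exists c.
Qed.

Definition row_word T : N.-tuple bool := [tuple in_first_row T i | i < N].

Lemma row_word_ballot T : ballot 0 (row_word T).
Proof.
have [inj rows cols] := SYT_props T.
pose w := nth false (row_word T).
have wE (i : 'I_N) : w i = in_first_row T i by rewrite /w -tnth_nth tnth_mktuple.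
pose flip (r : 'I_2) : 'I_2 := if r == ord0 then ord_max else ord0.
have [|col _ colK] := inj_card_bij inj; first by rewrite card_prod !card_ord.
have colK' := inj_can_sym colK inj.
pose f := extend (fun i => val T (flip (col i).1, (col i).2)).
have fE r c : f (val T (r, c)) = val T (flip r, c) by rewrite /f extendE colK'.
have cases x : x < N -> exists r c, x = val T (r, c).
  by move=> xN; have [r [c e]] := SYT_surj T (Ordinal xN); exists r, c; rewrite e.
apply/ballot_dyck; rewrite size_tuple -/w; apply: (dyck_of_pairing (f := f)) => x.
case/cases=> r [c ->]; rewrite !fE !wE !in_first_rowE ltn_ord.
by case: (ord2P r) => ->; split=> //=; apply: cols.
Qed.

Lemma SYTtoNCM_spec T : ncm (SYTtoNCM T) /\ opener_word (SYTtoNCM T) = row_word T.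
Proof.
have same M : ncm M -> [forall i, smaller_endpoint M i == in_first_row T i]
    = (opener_word M == row_word T).
  move=> nM; apply/forallP/eqP => [e|e i].
    apply: eq_from_tnth => i; rewrite !tnth_mktuple -(eqP (e i)).
    by rewrite smaller_endpointE // ncm_perfect.
  have := congr1 (fun t => tnth t i) e; rewrite !tnth_mktuple => <-.
  by rewrite smaller_endpointE // ncm_perfect.
have [M0 nM0 eM0] := dyck_ncm (row_word_ballot T).
rewrite /SYTtoNCM; case: pickP => [M /andP[]|/(_ M0)].
  by rewrite inE -/(ncm M) => nM; rewrite same // => /eqP.
by rewrite inE -/(ncm M0) nM0 same // eM0 eqxx.
Qed.

(** The rows are increasing, so that their sets of entries determine them. *)
Lemma SYTtoNCM_inj : injective (@SYTtoNCM n).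
Proof.
move=> T T' e.
have first i : in_first_row T i = in_first_row T' i.
  have [_ eT] := SYTtoNCM_spec T; have [_ eT'] := SYTtoNCM_spec T'.
  have := congr1 (fun t => tnth t i) eT; rewrite e eT' !tnth_mktuple => <- //.
have sortedrow (S : SYT n) r : sorted ltn [seq val (val S (r, c)) | c <- enum 'I_n].
  have [_ rows _] := SYT_props S.
  apply: (homo_sorted (e := fun c c' : 'I_n => c < c')) => [c c'|]; first exact: rows.
  by have := iota_ltn_sorted 0 n; rewrite -val_enum_ord sorted_map.
have memrow (S : SYT n) r x : (x \in [seq val (val S (r, c)) | c <- enum 'I_n])
    = [exists i : 'I_N, (x == i) && (in_first_row S i == (r == ord0))].
  apply/mapP/existsP => [[c _ ->]|[i /andP[/eqP -> /eqP]]].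
    by exists (val S (r, c)); rewrite in_first_rowE !eqxx.
  have [r' [c <-]] := SYT_surj S i; rewrite in_first_rowE => er.
  have -> : r = r' by move: er; case: (ord2P r) => ->; case: (ord2P r') => ->.
  by exists c; rewrite ?mem_enum.
apply: val_inj; apply/ffunP => -[r c].
have : [seq val (val T (r, c)) | c <- enum 'I_n]
     = [seq val (val T' (r, c)) | c <- enum 'I_n].
  apply: (irr_sorted_eq ltn_trans ltnn) => // x; rewrite !memrow.
  by apply: eq_existsb => i; rewrite first.
by move/eq_in_map => /(_ c (mem_enum _ _)) /val_inj.
Qed.

(** The opening and the closing points, in increasing order, are the two rows; the
    columns increase because the word of the matching is a Dyck word. *)
Lemma SYTtoNCM_surj M : ncm M -> exists T, SYTtoNCM T = M.
Proof.
move=> nM; pose w := nth false (opener_word M).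
have := opener_word_ballot nM; move/ballot_dyck; rewrite size_tuple -/w => -[pre tot].
pose A := filter w (iota 0 N); pose B := filter (predC w) (iota 0 N).
have sA : size A = n by rewrite size_filter -/(ups w 0 N); lia.
have sB : size B = n.
  by rewrite size_filter; have := ups_downs w 0 N; lia.
have srtA : sorted ltn A by apply: sorted_filter (iota_ltn_sorted _ _); apply: ltn_trans.
have srtB : sorted ltn B by apply: sorted_filter (iota_ltn_sorted _ _); apply: ltn_trans.
pose row (r : 'I_2) := if r == ord0 then A else B.
have rowE r x : (x \in row r) = (x < N) && (w x == (r == ord0)).
  by rewrite /row; case: eqP => _; rewrite mem_filter mem_iota /= add0n andbC ?eqb_id ?eqbF_neg.
have srow r : size (row r) = n by rewrite /row; case: eqP.
have mrow r (c : 'I_n) : nth 0 (row r) c \in row r by rewrite mem_nth // srow.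
have lt r (c : 'I_n) : nth 0 (row r) c < N by have := mrow r c; rewrite rowE => /andP[].
pose t := [ffun x : 'I_2 * 'I_n => Ordinal (lt x.1 x.2)].
have tE r c : t (r, c) = nth 0 (row r) c :> nat by rewrite ffunE.
have srt r : sorted ltn (row r) by rewrite /row; case: eqP.
have rows r (c c' : 'I_n) : c < c' -> t (r, c) < t (r, c').
  by move=> cc'; rewrite !tE; apply: (sorted_ltn_nth ltn_trans); rewrite // inE srow.
have lts (P : pred nat) x : x <= N ->
    count (fun y => y < x) (filter P (iota 0 N)) = count P (iota 0 x).
  move=> xN; rewrite -(subnKC xN) iotaD filter_cat count_cat add0n.
  rewrite !count_filter [X in _ + X](_ : _ = 0); last first.
    apply/eqP; rewrite -leqn0 leqNgt -has_count; apply/hasPn => y.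
    by rewrite mem_iota /=; lia.
  by rewrite addn0; apply: eq_in_count => y; rewrite mem_iota /= => ->.
have tP : is_SYT t.
  apply/and3P; split.
  - apply/injectiveP => -[r c] [r' c'] /(congr1 val) /=; rewrite !tE => e.
    have er : r = r'.
      have := mrow r c; rewrite rowE e => /andP[_ /eqP er].
      have := mrow r' c'; rewrite rowE er => /andP[_].
      by case: (ord2P r) => ->; case: (ord2P r') => ->.
    congr (_, _) => //; apply: ord_inj; subst r'; apply/eqP.
    rewrite -(nth_uniq 0 (s := row r)) ?srow ?e //.
    exact: sorted_uniq ltn_trans ltnn _ (srt r).
  - by apply/forallP => r; apply/forallP => c; apply/forallP => c'; apply/implyP/rows.
  apply/forallP => c; apply/forallP => r; apply/forallP => r'; apply/implyP.
  case: (ord2P r) => ->; case: (ord2P r') => -> // _; rewrite !tE /row /=.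
  have bN : nth 0 B c < N by apply: (lt ord_max).
  have ab : nth 0 A c <> nth 0 B c.
    move=> e; have := mrow ord0 c; have := mrow ord_max c.
    by rewrite !rowE /= /row /= e => /andP[_ /eqP->] /andP[_].
  have : nth 0 B c < (nth 0 B c).+1 by [].
  rewrite (sorted_count_lt _ srtB) ?sB // lts // => cB.
  have : nth 0 A c < (nth 0 B c).+1.
    rewrite (sorted_count_lt _ srtA) ?sA // lts //.
    have := pre _ bN; have := ups_downs w 0 (nth 0 B c).+1; rewrite -/(ups w 0 _); lia.
  lia.
exists (Sub t tP); have [nM' eM'] := SYTtoNCM_spec (Sub t tP).
apply: opener_word_inj => //; rewrite eM'; apply: eq_from_tnth => i.
rewrite [LHS]tnth_mktuple (tnth_nth false) -/w; apply/existsP/idP => [[c /eqP]|wi].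
  rewrite SubK => <-; rewrite tE; have := mrow ord0 c; rewrite rowE => /andP[_ /eqP->] //.
have : (i : nat) \in row ord0 by rewrite rowE ltn_ord wi.
move/(nthP 0) => [c]; rewrite srow => cn e; exists (Ordinal cn).
by rewrite SubK; apply/eqP/ord_inj; rewrite tE.
Qed.

Lemma SYTtoNCM_promotion T : SYTtoNCM (promotion T) = rot_matching (SYTtoNCM T).
Proof.
rewrite /promotion; case: pickP => [T' /eqP //|none]; exfalso.
have [nM _] := SYTtoNCM_spec T.
by have [T' e] := SYTtoNCM_surj (rot_ncm nM); have := none T'; rewrite e eqxx.
Qed.

Lemma SYTtoNCM_iter_promotion p T :
  SYTtoNCM (iter p (@promotion n) T) = iter p (@rot_matching N) (SYTtoNCM T).
Proof. by elim: p => //= p IH; rewrite SYTtoNCM_promotion IH. Qed.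

(** Both sides say that j is in the first row and j + 1 in the second one. *)
Lemma mem_Des T (j j' : 'I_N) : j' = j.+1 :> nat ->
  (j \in Des T) = (mate (SYTtoNCM T) j == j').
Proof.
move=> jj'; have [nM eM] := SYTtoNCM_spec T.
rewrite (adjacent_mate nM jj') -!(nth_opener_word (SYTtoNCM T)) eM.
rewrite -!tnth_nth !tnth_mktuple inE; apply/existsP/andP => [[[r c] /existsP[[r' c']]]|].
  case/and3P => /eqP ej /eqP ej' lt.
  have -> : j' = val T (r', c') by apply: ord_inj; rewrite ej' jj'.
  by rewrite -ej !in_first_rowE; move: lt; case: (ord2P r) => ->; case: (ord2P r') => ->.
have [r [c ej]] := SYT_surj T j; have [r' [c' ej']] := SYT_surj T j'.
rewrite -ej -ej' !in_first_rowE => -[/eqP r0 r'0]; exists (r, c); apply/existsP.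
exists (r', c'); rewrite eqxx ej' jj' ej eqxx /= r0.
by move: r'0; case: (ord2P r') => ->.
Qed.

(** For the last point, the definition of cDes asks for the edge {1, 2} in the
    rotated matching, that is, for the edge {2n, 1} in the original one. *)
Lemma mem_cDes T (j : 'I_N) : (j \in cDes T) = (mate (SYTtoNCM T) j == ordS j).
Proof.
have [nM _] := SYTtoNCM_spec T; rewrite !inE.
have [ltj|gej] := ltnP j.+1 N.
  have jS : ordS j = j.+1 :> nat by rewrite ordS_val ltn_eqF.
  by rewrite ltn_eqF // orbF -(mem_Des T jS) inE.
have jN : j.+1 = N by have := ltn_ord j; lia.
rewrite jN eqxx [X in X || _](_ : _ = false) /=; last first.
  apply/existsP => -[x /existsP[x' /and3P[_ /eqP e _]]].
  by have := ltn_ord (val T x'); rewrite e; lia.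
have S0 : ordS j = 0 :> nat by rewrite ordS_val jN eqxx.
have S1 : ordS (ordS j) = (ordS j).+1 :> nat by rewrite ordS_val S0 ltn_eqF //; lia.
have D := mem_Des (promotion T) S1.
rewrite SYTtoNCM_promotion mate_rot ?ncm_perfect // (inj_eq (@ordS_inj N)) in D.
rewrite -D; apply/existsP/idP => [[i /andP[iD /eqP i0]]|Dj].
  by rewrite (_ : ordS j = i) //; apply: ord_inj; rewrite S0 i0.
by exists (ordS j); rewrite Dj S0 eqxx.
Qed.

Lemma SYTcdesE k T : (T \in SYTcdes n k) = (SYTtoNCM T \in NCMsh n k).
Proof.
have [nM _] := SYTtoNCM_spec T.
rewrite !inE -/(ncm _) nM short_edges ?ncm_perfect //; last lia.
by congr (_ == _); apply: eq_card => j; rewrite mem_cDes inE.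
Qed.

Lemma iter_promotion_period T : iter N (@promotion n) T = T.
Proof. by apply: SYTtoNCM_inj; rewrite SYTtoNCM_iter_promotion iter_rot_m. Qed.

Lemma rot_NCMsh k M : M \in NCMsh n k -> rot_matching M \in NCMsh n k.
Proof.
have shE M' : (M' \in NCMsh n k) = ncm M' && (#|[set i | mate M' i == ordS i]| == k).
  rewrite !inE -/(ncm M'); case nM' : (ncm M') => //=.
  by rewrite short_edges ?ncm_perfect //; lia.
rewrite !shE => /andP[nM /eqP <-]; rewrite rot_ncm //=; apply/eqP.
rewrite -[RHS](card_imset _ (@ordS_inj N)); apply: eq_card => i; rewrite -(ord_predK i).
rewrite (mem_imset _ _ (@ordS_inj N)) !inE mate_rot ?ncm_perfect //.
by rewrite (inj_eq (@ordS_inj N)).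
Qed.

Lemma card_fixed_promotion k p :
  #|[set T in SYTcdes n k | iter p (@promotion n) T == T]|
  = #|[set M in NCMsh n k | iter p (@rot_matching N) M == M]|.
Proof.
have fixE T : (iter p (@promotion n) T == T)
    = (iter p (@rot_matching N) (SYTtoNCM T) == SYTtoNCM T).
  by rewrite -SYTtoNCM_iter_promotion (inj_eq SYTtoNCM_inj).
rewrite -(card_imset _ SYTtoNCM_inj); apply: eq_card => M.
apply/imsetP/idP => [[T]|].
  by rewrite in_set SYTcdesE fixE => TX ->; rewrite in_set.
rewrite in_set => MX; have nM : ncm M by case/andP: MX => /setIdP[]; rewrite inE.
by have [T eT] := SYTtoNCM_surj nM; exists T; rewrite // in_set SYTcdesE fixE eT.
Qed.

End Tableaux.


Local Open Scope ring_scope.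

(** * Fixed points and values of Syt(n,k;q) *)

(** The coefficients of q^n Syt(n,k;q) are numbers of Dyck words by [dyck_sum]. *)
Lemma syt_coef_ge0 n k i : (2 <= n)%N -> (2 <= k)%N ->
  0 <= (syt ('X : {poly int}) n k)`_i.
Proof.
move=> le2n le2k.
have -> : (syt ('X : {poly int}) n k)`_i = ('X^n * syt 'X n k)`_(n + i).
  by rewrite coefXnM ltnNge leq_addr addKn.
rewrite -dyck_sum // /word_sum coef_sum; apply: Num.Theory.sumr_ge0 => t _.
by rewrite coefXn Num.Theory.ler0n.
Qed.

Lemma syt_horner (R : comNzRingType) (q : R) n k :
  (map_poly intr (syt ('X : {poly int}) n k)).[q] = syt q n k.
Proof.
have := syt_morph (horner_eval q \o map_poly intr) 'X n k.
by rewrite /= map_polyX /horner_eval hornerX.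
Qed.

Lemma card_NCMsh n k : (2 <= n)%N ->
  #|NCMsh n k| =
  #|[set t : (2 * n).-tuple bool | ballot 0 t && (cyclic_peaks t == k)]|.
Proof.
move=> le2n.
have XP M : (M \in NCMsh n k) = ncm M && (cyclic_peaks (opener_word M) == k).
  rewrite !inE -/(ncm M); case nM : (ncm M) => //=.
  by rewrite card_short_edges //; lia.
have inj : {in NCMsh n k &, injective (@opener_word (2 * n))}.
  by move=> M M'; rewrite !XP => /andP[nM _] /andP[nM' _]; apply: opener_word_inj.
rewrite -(card_in_imset inj); congr #|pred_of_set _|; apply/setP => t.
apply/imsetP/idP => [[M]|]; rewrite inE.
  by rewrite XP => /andP[nM kM] ->; rewrite opener_word_ballot.
case/andP=> /dyck_ncm[M nM <-] kM; exists M => //.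
by rewrite XP nM.
Qed.

Lemma card_NCMsh_syt (R : comNzRingType) n k : (2 <= n)%N -> (2 <= k)%N ->
  #|NCMsh n k|%:R = syt (1 : R) n k.
Proof.
move=> le2n le2k; rewrite card_NCMsh //.
have := dyck_sum (1 : R) le2n le2k; rewrite expr1n mul1r => <-.
rewrite -sum1dep_card natr_sum /word_sum; apply: eq_bigr => t _.
by rewrite expr1n.
Qed.

(** Three cases. If r divides n, the words have period 2n/r and are balanced. If r
    does not divide n and r > 2, there are none. If r = 2 and n is odd, there is
    a diameter and the words have one surplus letter. *)
Lemma card_fixed_matchings_nontrivial (F : fieldType) (w : F) n p r k :
  (2 <= n)%N -> (2 <= k)%N -> (2 * n = r * p)%N -> (2 <= r)%N ->
  r.-primitive_root w ->
  #|[set M in NCMsh n k | iter p (@rot_matching (2 * n)) M == M]|%:R = syt w n k.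
Proof.
move=> le2n le2k Nrp r_gt1 w_prim.
have p_gt0 : (0 < p)%N by case: p Nrp; lia.
rewrite (card_fixed_matchings le2n p_gt0 Nrp r_gt1).
have [/dvdnP[m nmr]|rn] := boolP (r %| n)%N.
  have m_gt0 : (0 < m)%N by case: m nmr le2n; lia.
  have p2m : p = (m + m)%N.
    by apply/eqP; rewrite -(eqn_pmul2l (ltnW r_gt1)) -Nrp nmr; lia.
  have kE := divn_eq k r.
  have ltkr : (k %% r < r)%N by rewrite ltn_mod; lia.
  rewrite [in syt _ n]nmr [in RHS]kE (syt_root_dvd r_gt1) //; try by rewrite -?kE -?nmr.
  have adm (t : seq bool) : admissible p r t = (count id t == m).
    by rewrite /admissible p2m; lia.
  case: eqP => [r0|/eqP rk]; last first.
    rewrite (_ : [set _ | _] = set0) ?cards0 //; apply/setP => t; rewrite !inE.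
    by apply/negP => /andP[_ /eqP ek]; rewrite -ek modnMr in rk.
  have s_gt0 : (0 < k %/ r)%N.
    by rewrite divn_gt0; [apply: dvdn_leq; [lia | exact/eqP] | lia].
  rewrite r0 addn0 in kE; move: (k %/ r)%N kE s_gt0 => [//|s] kE _.
  case: m m_gt0 p2m adm {nmr} => // m _ p2m adm.
  congr (_%:R); rewrite -[m.+1.-1]/m -[s.+1.-1]/s.
  have -> : (2 * 'C(m.+1, s.+1) * 'C(m, s)
    = 'C(m.+1, s.+1) * 'C(m, s) + 'C(m, s) * 'C(m.+1, s.+1))%N by ring.
  rewrite -(card_circ_peaks s p2m); apply: eq_card => t; rewrite !inE adm kE mulnC.
  by rewrite eqn_pmul2r //; lia.
have [r2|r2] := eqVneq r 2%N; last first.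
  have r_gt2 : (2 < r)%N by lia.
  have r2n : (r %| 2 * n)%N by rewrite Nrp dvdn_mulr.
  rewrite (syt_root_ndvd r_gt1 w_prim le2n le2k r_gt2 r2n rn).
  rewrite (_ : [set _ | _] = set0) ?cards0 //; apply/setP => t; rewrite !inE.
  rewrite /admissible (negPf r2) andbF orbF; apply/negP => /andP[/eqP ep _].
  case/negP: rn; apply/dvdnP; exists (count id t).
  move: (count id t) ep => c ep; apply/eqP.
  by rewrite -(eqn_pmul2l (isT : (0 < 2)%N)) Nrp -ep; apply/eqP; ring.
subst r; move: rn; rewrite dvdn2 negbK => n_odd.
have pn : p = n by lia.
have [m nm] : exists m, n = (2 * m).+1 by exists n./2; lia.
have m_gt0 : (0 < m)%N by lia.
have [s [t kE]] : exists s (t : bool), k = (2 * s + t)%N.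
  by exists k./2, (odd k); lia.
have s_gt0 : (0 < s)%N by case: (t) kE; lia.
rewrite [in RHS]kE [in syt w n]nm syt_neg1_odd //.
have adm (u : seq bool) : admissible p 2 u = (count id u == m.+1).
  by rewrite /admissible pn nm; lia.
case: t kE => /= kE.
  rewrite (_ : [set _ | _] = set0) ?cards0 //; apply/setP => u; rewrite !inE.
  by apply/negP => /andP[_ /eqP ek]; lia.
case: m m_gt0 nm adm => // m _ nm adm; case: s s_gt0 kE => // s _ kE.
have pE : p = (m.+2 + m.+1)%N by lia.
congr (_%:R); rewrite -[m.+1.-1]/m -[s.+1.-1]/s.
have -> : ('C(m.+2, s.+1) * 'C(m, s) + 'C(m.+1, s.+1) * 'C(m.+1, s)
  = 'C(m.+2, s.+1) * 'C(m, s) + 'C(m.+1, s) * 'C(m.+1, s.+1))%N by ring.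
rewrite -(card_circ_peaks s pE); apply: eq_card => u; rewrite !inE adm kE.
by congr (_ && _); lia.
Qed.

Lemma card_fixed_matchings_syt (F : fieldType) (w : F) n p r k :
  (2 <= n)%N -> (2 <= k)%N -> (2 * n = r * p)%N -> r.-primitive_root w ->
  #|[set M in NCMsh n k | iter p (@rot_matching (2 * n)) M == M]|%:R = syt w n k.
Proof.
move=> le2n le2k Nrp w_prim; case: (ltnP 1 r) => [r_gt1|r_le1].
  exact: card_fixed_matchings_nontrivial w_prim.
have r1 : r = 1%N by case: r Nrp r_le1 {w_prim} => [|[|]] //; lia.
subst r; have -> : w = 1 by rewrite -[w]expr1 (prim_expr_order w_prim).
rewrite -card_NCMsh_syt //; congr (_%:R); apply: eq_card => M.
by rewrite !inE -[p]mul1n -Nrp iter_rot_m eqxx andbT.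
Qed.

(** * Cyclic sieving *)

Section IterPeriod.
Variables (N : nat) (T : Type) (s : T -> T).
Hypothesis sN : forall x, iter N s x = x.

Lemma iter_period_mul c x : iter (c * N) s x = x.
Proof. by elim: c => //= c IH; rewrite mulSn iterD IH. Qed.

Lemma iter_period_mod e x : iter (e %% N) s x = iter e s x.
Proof. by rewrite {2}(divn_eq e N) addnC iterD iter_period_mul. Qed.

Lemma iter_period_gcd e x : (0 < N)%N ->
  iter e s x = x <-> iter (gcdn e N) s x = x.
Proof.
move=> N0; have fixM c d : iter c s x = x -> iter (d * c) s x = x.
  by move=> fc; elim: d => //= d IH; rewrite mulSn iterD IH.
split=> [fe|fg]; last by rewrite -(divnK (dvdn_gcdl e N)); apply: fixM.
have [a _ /dvdnP[c ec]] := Bezoutl e N0.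
rewrite -[in LHS](fixM e a fe) -iterD gcdnC ec iter_period_mul //.
Qed.
End IterPeriod.

(** If s has period N then s^d fixes the same points as s^p with p = gcd(d, N), and
    xi^d is a primitive root of unity of order N/p. *)
Lemma cyclic_sieving_of_rotations (N : nat) (T : finType) (s : T -> T) (X : {set T})
    (f : {poly int}) :
  (1 < N)%N -> (forall x, iter N s x = x) -> (forall x, x \in X -> s x \in X) ->
  (forall i : nat, 0 <= f`_i) ->
  (forall (w : algC) p r, (N = r * p)%N -> r.-primitive_root w ->
     #|[set x in X | iter p s x == x]|%:R = (map_poly intr f).[w]) ->
  cyclic_sieving (Zp1 : 'Z_N) (iter_action (N := N) s) X f.
Proof.
move=> N1 sN sX f0 fixed; have N0 : (0 < N)%N by lia.
have trunc := Zp_cast N1.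
have order1 : #[Zp1 : 'Z_N]%g = N by rewrite order_Zp1.
have sinj : injective s.
  move=> x y e; rewrite -(sN x) -(sN y) -(prednK N0) !iterSr.
  by rewrite e.
split=> //.
- split=> [a x y /= | x a b _ _ /=].
    by rewrite /iter_action; elim: (nat_of_ord a) => //= k IH /sinj/IH.
  have modE y : iter (y %% (Zp_trunc N).+2) s x = iter y s x.
    by rewrite trunc iter_period_mod.
  by rewrite /iter_action /= modE addnC iterD.
- move=> x a xX _; rewrite /iter_action.
  by elim: (nat_of_ord a) => //= k; apply: sX.
move=> xi d; rewrite order1 => xi_prim.
set e := nat_of_ord (expgz (Zp1 : 'Z_N) d).
have xi_e : xi ^ d = xi ^+ e.
  have pos m : nat_of_ord ((Zp1 : 'Z_N) ^+ m)%g = (m %% N)%N.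
    by rewrite Zp_expg /= modnMml mul1n trunc.
  rewrite {}/e; case: d => m /=; first by rewrite pos (prim_expr_mod xi_prim).
  have xi0 : xi ^+ m.+1 != 0.
    rewrite expf_neq0 //; apply/eqP => xi0; have := prim_expr_order xi_prim.
    by rewrite xi0 expr0n gtn_eqF // => /esym/eqP; rewrite oner_eq0.
  apply: (mulfI xi0); rewrite NegzE -exprnN mulfV // -exprD.
  apply/esym/eqP; rewrite -(prim_order_dvd xi_prim) /dvdn -modnDml -[(m.+1 %% N)%N]pos.
  have := mulgV ((Zp1 : 'Z_N) ^+ m.+1)%g => /(congr1 (@nat_of_ord _)) /=.
  by rewrite [X in (_ %% X)%N = _]trunc => H; apply/eqP; exact: H.
rewrite xi_e -(fixed _ (gcdn e N) (N %/ gcdn e N)%N); last exact: exp_prim_root.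
  congr (_%:R); apply: eq_card => x; rewrite !inE; congr (_ && _).
  by apply/eqP/eqP => /(iter_period_gcd sN e x N0).
by rewrite divnK // dvdn_gcdr.
Qed.

Theorem theorem3 (n : nat) (hn : (2 <= n)%N) :
  (forall K : nat, (n < K)%N -> \sum_(2 <= k < K) qSyt n k = qCat n)
  /\ (forall k : nat, (2 <= k)%N ->
      exists f : {poly int},
        [/\ tofrac f = qSyt n k,
            cyclic_sieving (Zp1 : 'Z_(2 * n))
              (iter_action (N := 2 * n) (@promotion n)) (SYTcdes n k) f
          & cyclic_sieving (Zp1 : 'Z_(2 * n))
              (iter_action (N := 2 * n) (@rot_matching (2 * n))) (NCMsh n k) f]).
Proof.
split=> [K ltnK|k le2k]; first exact: sum_qSyt.
have N1 : (1 < 2 * n)%N by lia.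
exists (syt 'X n k); split; first by rewrite qSytE.
  apply: cyclic_sieving_of_rotations => //.
  - exact: iter_promotion_period.
  - by move=> T; rewrite !SYTcdesE // SYTtoNCM_promotion //; apply: rot_NCMsh.
  - by move=> i; apply: syt_coef_ge0.
  move=> w p r Nrp w_prim; rewrite card_fixed_promotion // syt_horner.
  exact: card_fixed_matchings_syt Nrp w_prim.
apply: cyclic_sieving_of_rotations => //.
- exact: iter_rot_m.
- by move=> M; apply: rot_NCMsh.
- by move=> i; apply: syt_coef_ge0.
move=> w p r Nrp w_prim; rewrite syt_horner.
exact: card_fixed_matchings_syt Nrp w_prim.
Qed.
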